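(* Let $G$ be a countable directed graph and let $\mathrm{S}=(S_v,S_e)$ be an atomic (nondegenerate) TCK family for $G$. Then $\mathrm{S}$ decomposes as a direct sum of representations of left regular type, inductive type and cycle type; that is, $\mathrm{S}$ is unitarily equivalent to a direct sum of families each of which is of the form $\mathrm{L}_{G,v}$ ($v\in V$), or $\mathrm{S}_\tau$ ($\tau$ an infinite backward path in $G$), or $\mathrm{S}_{w,\lambda}$ ($w$ a cycle in $G$, $\lambda\in\mathbb{T}$).
   Context: A directed graph $G=(V,E,s,r)$ has countable $V$, $E$ and source and range maps $s,r:E\to V$. $\mathbb{F}_G^+$ is the set of finite paths $\mu=e_n\cdots e_1$ ($s(e_{i+1})=r(e_i)$), $s(\mu)=s(e_1)$, $r(\mu)=r(e_n)$; vertices are paths of length $0$. A cycle is a path of length $\ge1$ with equal source and range. A TCK family $\mathrm{S}=(S_v,S_e)$ on $\mathcal{H}$: $\{S_v\}$ pairwise orthogonal projections; $S_e^*S_e=S_{s(e)}$; $\sum_{e\in F}S_eS_e^*\le S_v$ for finite $F\subseteq r^{-1}(v)$. Nondegenerate: $\sum_vS_v=I$ (SOT). Atomic: there are pairwise disjoint sets $\{\Lambda_v\}_{v\in V}$, an orthonormal basis $\{\xi_{v,i}:v\in V,i\in\Lambda_v\}$ of $\mathcal{H}$ and injections $\pi_e:\Lambda_{s(e)}\to\Lambda_{r(e)}$ such that (1) $S_v$ is the projection onto $\overline{\operatorname{span}}\{\xi_{v,i}:i\in\Lambda_v\}$; (2) for $e\in E$, $i\in\Lambda_{s(e)}$ there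 are scalars $\lambda_{e,i}\in\mathbb{T}$ with $S_e\xi_{s(e),i}=\lambda_{e,i}\xi_{r(e),\pi_e(i)}$, and $S_e$ kills all other basis vectors; (3) for each $v$, the ranges of $\{\pi_e:r(e)=v\}$ are pairwise disjoint. Left regular type $\mathrm{L}_{G,v}$: on $\mathcal{H}_{G,v}$ with orthonormal basis $\{\xi_\mu:\mu\in\mathbb{F}_G^+,s(\mu)=v\}$, $L_u\xi_\mu=\xi_\mu$ if $r(\mu)=u$, else $0$; $L_e\xi_\mu=\xi_{e\mu}$ if $s(e)=r(\mu)$, else $0$. Inductive type $\mathrm{S}_\tau$: $\tau=e_{-1}e_{-2}e_{-3}\cdots$ is an infinite backward path, i.e. $s(e_{i})=r(e_{i-1})$ for $i\le-1$. Put $v_0=r(e_{-1})$ and $v_i=s(e_i)$ for $i\le-1$. Let $\mathcal{H}_i=\mathcal{H}_{G,v_i}$ carry $\mathrm{L}^{(i)}=\mathrm{L}_{G,v_i}$ ($i\le0$), and let $J_i:\mathcal{H}_i\to\mathcal{H}_{i-1}$ be the isometry $J_i\xi_\mu=\xi_{\mu e_{i-1}}$, which intertwines $\mathrm{L}^{(i)}$ and $\mathrm{L}^{(i-1)}$. $\mathcal{H}_\tau=\varinjlim(\mathcal{H}_i,J_i)$ with natural isometric injections $K_i:\mathcal{H}_i\to\mathcal{H}_\tau$, and $\mathrm{S}_\tau$ is the family determined by $S_\mu K_i=K_iL^{(i)}_\mu$ for all $\mu\in\mathbb{F}_G^+$, $i\le0$. Cycle type $\mathrm{S}_{w,\lambda}$: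 $w=e_k\cdots e_1$ a cycle, $\lambda\in\mathbb{T}$. $\mathcal{H}_w=\mathbb{C}^k\oplus\bigoplus_{j=1}^k\bigoplus_{f\ne e_j,\,s(f)=s(e_j)}\mathcal{H}_{G,r(f)}$, with orthonormal basis $\xi_1,\dots,\xi_k$ of $\mathbb{C}^k$ and basis $\{\xi_{j,f,\mu}:s(\mu)=r(f)\}$ of the $(j,f)$ summand. $S_v\xi_j=\delta_{v,s(e_j)}\xi_j$, $S_v\xi_{j,f,\mu}=\delta_{v,r(\mu)}\xi_{j,f,\mu}$; $S_e\xi_j=\xi_{j+1}$ if $e=e_j$, $j<k$; $S_e\xi_k=\lambda\xi_1$ if $e=e_k$; $S_e\xi_j=\xi_{j,e,r(e)}$ if $e\ne e_j$, $s(e)=s(e_j)$; $S_e\xi_j=0$ if $s(e)\ne s(e_j)$; $S_e\xi_{j,f,\mu}=\xi_{j,f,e\mu}$ if $s(e)=r(\mu)$, and $0$ otherwise. *)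

(* Defs.v *)
From HB Require Import structures.
From mathcomp Require Import all_boot all_order all_algebra finmap sesquilinear.
From mathcomp Require Import complex ring lra.
From mathcomp Require Import boolp classical_sets functions reals topology normedtype.
From mathcomp Require Import summability.
Set Implicit Arguments.
Unset Strict Implicit.
Unset Printing Implicit Defensive.
Import Order.TTheory GRing.Theory Num.Theory numFieldNormedType.Exports.
Local Open Scope ring_scope.
Local Open Scope classical_set_scope.

(* The inner product is linear in its first argument; the topology and the
   completeness come from the underlying complete normed module. *)
HB.mixin Record isHilbert (R : realType) H & CompleteNormedModule R[i] H := {
  inner : H -> H -> R[i] ;
  inner_linear : forall z, scalar (inner ^~ z) ;
  inner_sym : forall x y, inner x y = (inner y x)^* ;
  inner_norm : forall x, inner x x = `|x| ^+ 2
}.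
#[short(type="hilbertType")]
HB.structure Definition Hilbert (R : realType) :=
  {H of CompleteNormedModule R[i] H & isHilbert R H}.

Section InnerTheory.
Variables (R : realType) (H : hilbertType R).
Implicit Types x y z : H.

Lemma innerDl z x y : inner (x + y) z = inner x z + inner y z.
Proof. by have := inner_linear z 1 x y; rewrite scale1r mul1r. Qed.

Lemma inner0l z : inner 0 z = 0 :> R[i].
Proof. by apply: (addrI (inner 0 z)); rewrite -innerDl !addr0. Qed.

Lemma innerZl z a x : inner (a *: x) z = a * inner x z.
Proof. by have := inner_linear z a x 0; rewrite !addr0 inner0l addr0. Qed.

Lemma innerDr z x y : inner z (x + y) = inner z x + inner z y.
Proof. by rewrite inner_sym innerDl rmorphD/= [inner z x]inner_sym [inner z y]inner_sym. Qed.

Lemma innerZr z a x : inner z (a *: x) = a^* * inner z x.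
Proof. by rewrite inner_sym innerZl rmorphM/= [inner z x]inner_sym. Qed.

Lemma inner_bilinear :
  bilinear_for *%R (Num.conj \; *%R) (@inner R H).
Proof.
split=> [z a x y|z a x y] /=.
  exact: inner_linear.
by rewrite innerDr innerZr.
Qed.

HB.instance Definition _ := bilinear_isBilinear.Build R[i] H H R[i]
  *%R (Num.conj \; *%R) (@inner R H) inner_bilinear.

Let inner_hermitian x y : inner x y = (-1) ^+ false * (inner y x)^*.
Proof. by rewrite mul1r inner_sym. Qed.

HB.instance Definition _ := isHermitianSesquilinear.Build R[i] H false
  Num.conj (@inner R H) inner_hermitian.

Let inner_gt0 x : x != 0 -> 0 < inner x x.
Proof. by move=> x0; rewrite inner_norm exprn_gt0// normr_gt0. Qed.

HB.instance Definition _ := isDotProduct.Build R[i] H (@inner R H) inner_gt0.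

End InnerTheory.

Section DotTheory.
Variables (C : numClosedFieldType) (U : lmodType C) (form : {dot U for Num.conj}).
Local Notation "''[' u , v ]" := (form u%R v%R) : ring_scope.
Local Notation "''[' u ]" := '[u, u]%R : ring_scope.

Lemma dot_CauchySchwarz u v : `|'[u, v]| ^+ 2 <= '[u] * '[v].
Proof.
have [->|v0] := eqVneq v 0; first by rewrite !linear0r normr0 expr0n mulr0.
have v_gt0 : 0 < '[v] by rewrite dnorm_gt0.
rewrite -(ler_pM2l v_gt0) -subr_ge0.
suff -> : '[v] * ('[u] * '[v]) - '[v] * `|'[u, v]| ^+ 2 =
  '[ '[v] *: u - '[u, v] *: v] by exact: dnorm_ge0.
have vv : ('[v])^* = '[v] by rewrite conj_Creal// ger0_real// ltW.
rewrite dnormB !dnormZ/= linearZl_LR/= linearZr_LR/= (ger0_norm (ltW v_gt0)).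
rewrite !rmorphM/= conjCK vv normCK.
move: (form u v)^* => d.
ring.
Qed.

Lemma dot_triangle u v : sqrtC '[u + v] <= sqrtC '[u] + sqrtC '[v].
Proof.
rewrite -ler_sqr ?rpredD ?nnegrE ?sqrtC_ge0 ?addr_ge0 ?sqrtC_ge0//.
rewrite sqrrD !sqrtCK addrAC dnormD lerD2l.
rewrite -mulr_natr -[_ + _](divfK (negbT (pnatr_eq0 C 2))) .
rewrite ler_pM2r ?ltr0n//; rewrite -ReE; apply: (le_trans (leif_Re_Creal _).1).
rewrite -ler_sqr ?nnegrE ?mulr_ge0 ?sqrtC_ge0//.
by rewrite exprMn !sqrtCK dot_CauchySchwarz.
Qed.
End DotTheory.

(* [partial_sum f J] is the sum of [f] over the finite set [J], and [totally] is
   the filter of tails of the directed set of finite sets, so that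
   [partial_sum f @ totally --> l] is unconditional convergence to [l]. *)
#[global] Existing Instance totally_filter.

Section Sums.
Variables (R : realType) (I : choiceType).
Local Notation C := R[i].
Implicit Types (J : {fset I}).

Lemma partial_sum_le (a b : I -> C) J : (forall i, a i <= b i) ->
  partial_sum a J <= partial_sum b J.
Proof. by move=> ab; apply: ler_sum => i _. Qed.

Lemma partial_sumD (W : zmodType) (a b : I -> W) J :
  partial_sum (fun i => a i + b i) J = partial_sum a J + partial_sum b J.
Proof. exact: big_split. Qed.

Lemma partial_sumZ (W : lmodType C) c (a : I -> W) J :
  partial_sum (fun i => c *: a i) J = c *: partial_sum a J.
Proof. by rewrite /partial_sum scaler_sumr. Qed.

Lemma partial_sumE (W : zmodType) (a : I -> W) J :
  partial_sum a J = \sum_(i <- J) a i.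
Proof. by rewrite big_seq_fsetE. Qed.

Lemma partial_sum_mono (a : I -> C) J J' : (forall i, 0 <= a i) ->
  (J `<=` J')%fset -> partial_sum a J <= partial_sum a J'.
Proof.
move=> a0 JJ'; rewrite !partial_sumE.
rewrite [leRHS](big_fsetID _ (mem J)) /=.
rewrite [X in _ <= X + _](_ : _ = \sum_(i <- J) a i).
  by rewrite lerDl sumr_ge0.
apply: eq_fbigl => i; rewrite !inE /= andbC.
by case: (boolP (i \in J)) => //= iJ; rewrite (fsubsetP JJ').
Qed.

Lemma nonneg_cvg (a : I -> C^o) (M : C) : (forall i, 0 <= a i) ->
  (forall J, partial_sum a J <= M) ->
  exists l : C^o, [/\ partial_sum a @ totally --> l,
    forall J, partial_sum a J <= l &
    forall N : C, (forall J, partial_sum a J <= N) -> l <= N].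
Proof.
move=> a0 aM.
have s0 J : 0 <= partial_sum a J by apply: sumr_ge0 => i _.
have sR J : (complex.Re (partial_sum a J))%:C%C = partial_sum a J.
  by rewrite RRe_real// ger0_real.
have MR N : (forall J, partial_sum a J <= N) -> (complex.Re N)%:C%C = N.
  by move=> h; rewrite RRe_real// ger0_real// (le_trans (s0 fset0)).
pose S := [set complex.Re (partial_sum a J) | J in setT].
have hS : has_sup S.
  split; first by exists (complex.Re (partial_sum a fset0)), fset0.
  exists (complex.Re M) => _ [J _ <-].
  by rewrite -lecR sR (MR M).
have sub J : partial_sum a J <= (sup S)%:C%C.
  by rewrite -sR lecR; apply: sup_upper_bound => //; exists J.
exists (sup S)%:C%C; split=> //; last first.
  move=> N aN; rewrite -(MR _ aN) lecR; apply: ge_sup; first by case: hS.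
  by move=> _ [J _ <-]; rewrite -lecR sR (MR N).
apply/cvgrPdist_lt => e e0.
have eR : (complex.Re e)%:C%C = e by rewrite RRe_real// gtr0_real.
have e0' : 0 < complex.Re e by rewrite -ltcR eR.
have [_ [J _ <-] hJ] := sup_adherent e0' hS.
exists J => // J' JJ' /=.
rewrite ger0_norm ?subr_ge0// ltrBlDr -ltrBlDl.
have : (sup S - complex.Re e)%:C%C < partial_sum a J by rewrite -sR ltcR.
rewrite rmorphB/= eR => h; apply: lt_le_trans h _.
exact: partial_sum_mono.
Qed.

Lemma abs_cvg (a : I -> C^o) (b : I -> C) (M : C) :
  (forall i, `|a i| <= b i) -> (forall J, partial_sum b J <= M) ->
  exists l : C^o, partial_sum a @ totally --> l.
Proof.
move=> ab bM.
have key (f : I -> C) : (forall i, 0 <= f i) -> (forall i, f i <= 2 * b i) ->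
    exists l : C^o, partial_sum (f : I -> C^o) @ totally --> l.
  move=> f0 fb; have [|l [? _ _]] := @nonneg_cvg f (2 * M) f0; last by exists l.
  move=> J; apply: (@le_trans _ _ (partial_sum (fun i => 2 *: (b i : C^o)) J)).
    exact: partial_sum_le.
  by rewrite partial_sumZ ler_pM2l.
have b0 i : 0 <= b i by apply: le_trans (ab i).
have bb i : b i <= 2 * b i by rewrite mulr_natl mulr2n lerDl.
have [l1 h1] := key b b0 bb.
have Rb i : b i \is Num.real by rewrite ger0_real.
have hb (r : C) i : r \is Num.real -> `|r| <= `|a i| -> 0 <= b i + r /\ b i + r <= 2 * b i.
  move=> rR ra; have := le_trans ra (ab i).
  rewrite real_ler_norml// => /andP[h h'].
  by rewrite -lerBlDl sub0r h mulr_natl mulr2n lerD2l.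
have [l2 h2] : exists l : C^o,
    partial_sum (fun i => b i + 'Re (a i) : C^o) @ totally --> l.
  by apply: key => i; case: (hb _ i (Creal_Re (a i)) (leif_normC_Re_Creal _).1).
have Im_le (z : C) : `|'Im z| <= `|z|.
  rewrite -ler_sqr ?nnegrE// [leRHS]normC2_Re_Im real_normK ?Creal_Im//.
  by rewrite lerDr real_exprn_even_ge0 ?Creal_Re.
have [l3 h3] : exists l : C^o,
    partial_sum (fun i => b i + 'Im (a i) : C^o) @ totally --> l.
  by apply: key => i; case: (hb _ i (Creal_Im (a i)) (Im_le _)).
have h21 := cvgB (FF := totally_filter) h2 h1.
have h31 := cvgB (FF := totally_filter) h3 h1.
have := cvgD (FF := totally_filter) h21 (cvgZl_tmp (FF := totally_filter) (k := 'i : C) h31).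
set g := (X in X @ _) => hg.
exists ((l2 - l1) + 'i *: (l3 - l1)).
rewrite (_ : partial_sum a = g)// {hg}; rewrite {}/g.
apply/funext => J /=; rewrite !fctE.
rewrite [X in _ = _ + X](_ : _ = 'i * (\sum_(i : J) (b (val i) + 'Im (a (val i)))
   - \sum_(i : J) b (val i)))//.
rewrite /partial_sum -!sumrB mulr_sumr -big_split/=; apply: eq_bigr => i _.
rewrite [LHS]Crect !(addrC (b _)) !addrK.
by [].
Qed.

End Sums.

(* The external Hilbert direct sum of a family of Hilbert spaces. *)
Section HilbertSum.
Variables (R : realType) (I : choiceType) (H : I -> hilbertType R).
Local Notation C := R[i].
Implicit Types (J : {fset I}).

Definition square_summable (x : forall i, H i) :=
  exists M : C, forall J, partial_sum (fun i => `|x i| ^+ 2) J <= M.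

Record hilbert_sum := HilbertSum {
  hs_val :> forall i, H i ;
  hs_summable : square_summable hs_val }.

HB.instance Definition _ := gen_eqMixin hilbert_sum.
HB.instance Definition _ := gen_choiceMixin hilbert_sum.

Lemma hs_ext (x y : hilbert_sum) : (forall i, x i = y i) -> x = y.
Proof.
case: x y => [x sx] [y sy] /= xy.
have {}xy : x = y by exact: functional_extensionality_dep.
by case: _ / xy sy => sy; congr HilbertSum; exact: Prop_irrelevance.
Qed.

Let ss0 : square_summable (fun i => 0).
Proof. by exists 0 => J; rewrite /partial_sum big1// => i _; rewrite normr0 expr0n. Qed.

Let sqD (r s : C) : 0 <= r -> 0 <= s -> (r + s) ^+ 2 <= 2 * r ^+ 2 + 2 * s ^+ 2.
Proof.
move=> r0 s0; rewrite -subr_ge0.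
have -> : 2 * r ^+ 2 + 2 * s ^+ 2 - (r + s) ^+ 2 = (r - s) ^+ 2 by ring.
by rewrite real_exprn_even_ge0// realB// ger0_real.
Qed.

Let ssD (x y : forall i, H i) : square_summable x -> square_summable y ->
  square_summable (fun i => x i + y i).
Proof.
move=> [M xM] [N yN]; exists (2 * M + 2 * N) => J.
apply: (@le_trans _ _ (partial_sum
  (fun i => 2 *: (`|x i| ^+ 2 : C^o) + 2 *: (`|y i| ^+ 2 : C^o)) J)).
  apply: partial_sum_le => i; apply: le_trans (sqD _ _) => //.
  by rewrite ler_sqr ?nnegrE ?addr_ge0// ler_normD.
rewrite partial_sumD !partial_sumZ; apply: lerD.
  by rewrite ler_pM2l//; exact: xM.
by rewrite ler_pM2l//; exact: yN.
Qed.

Let ssZ (a : C) (x : forall i, H i) : square_summable x -> square_summable (fun i => a *: x i).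
Proof.
move=> [M xM]; exists (`|a| ^+ 2 * M) => J.
rewrite (_ : partial_sum _ _ =
   `|a| ^+ 2 *: (partial_sum (fun i => `|x i| ^+ 2 : C^o) J)).
  by rewrite ler_wpM2l ?exprn_ge0//; exact: xM.
rewrite -partial_sumZ; congr partial_sum; apply/funext => i.
by rewrite normrZ exprMn.
Qed.

Let ssN (x : forall i, H i) : square_summable x -> square_summable (fun i => - x i).
Proof.
by move=> [M xM]; exists M => J; under eq_fun do rewrite normrN; exact: xM.
Qed.

Definition hs_zero := HilbertSum ss0.
Definition hs_opp (x : hilbert_sum) := HilbertSum (ssN (hs_summable x)).
Definition hs_add (x y : hilbert_sum) :=
  HilbertSum (ssD (hs_summable x) (hs_summable y)).
Definition hs_scale (a : C) (x : hilbert_sum) :=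
  HilbertSum (ssZ a (hs_summable x)).

Implicit Types x y z : hilbert_sum.

Let hs_addA : associative hs_add.
Proof. by move=> x y z; apply: hs_ext => i /=; rewrite addrA. Qed.
Let hs_addC : commutative hs_add.
Proof. by move=> x y; apply: hs_ext => i /=; rewrite addrC. Qed.
Let hs_add0 : left_id hs_zero hs_add.
Proof. by move=> x; apply: hs_ext => i /=; rewrite add0r. Qed.
Let hs_addN : left_inverse hs_zero hs_opp hs_add.
Proof. by move=> x; apply: hs_ext => i /=; rewrite addNr. Qed.

HB.instance Definition _ :=
  GRing.isZmodule.Build hilbert_sum hs_addA hs_addC hs_add0 hs_addN.

Let hs_scaleA a b (x : hilbert_sum) : hs_scale a (hs_scale b x) = hs_scale (a * b) x.
Proof. by apply: hs_ext => i /=; rewrite scalerA. Qed.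
Let hs_scale1 : left_id 1 hs_scale.
Proof. by move=> x; apply: hs_ext => i /=; rewrite scale1r. Qed.
Let hs_scaleDr : right_distributive hs_scale +%R.
Proof. by move=> a x y; apply: hs_ext => i /=; rewrite scalerDr. Qed.
Let hs_scaleDl x : {morph hs_scale^~ x : a b / a + b}.
Proof. by move=> a b; apply: hs_ext => i /=; rewrite scalerDl. Qed.

HB.instance Definition _ := GRing.Zmodule_isLmodule.Build C hilbert_sum
  hs_scaleA hs_scale1 hs_scaleDr hs_scaleDl.

Definition hs_inner (x y : hilbert_sum) : C :=
  lim (partial_sum (fun i => inner (x i) (y i) : C^o) @ totally).

Lemma hs_inner_cvg (x y : hilbert_sum) :
  partial_sum (fun i => inner (x i) (y i) : C^o) @ totally --> (hs_inner x y : C^o).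
Proof.
suff [l hl] : exists l : C^o,
    partial_sum (fun i => inner (x i) (y i) : C^o) @ totally --> l.
  by rewrite /hs_inner (cvg_lim _ hl)//; exact: norm_hausdorff.
have [M xM] := hs_summable x; have [N yN] := hs_summable y.
apply: (@abs_cvg _ _ _ (fun i => `|x i| ^+ 2 + `|y i| ^+ 2) (M + N)) => [i|J].
  have h := dot_CauchySchwarz (@inner R (H i)) (x i) (y i).
  have {h} : `|inner (x i) (y i)| <= `|x i| * `|y i|.
    by rewrite -ler_sqr ?nnegrE ?mulr_ge0// exprMn -!inner_norm.
  move=> h; apply: le_trans h _.
  have a0 : 0 <= `|x i| by []. have b0 : 0 <= `|y i| by [].
  move: (`|x i|) (`|y i|) a0 b0 => r s r0 s0.
  rewrite -subr_ge0.
  have -> : r ^+ 2 + s ^+ 2 - r * s = (r - s) ^+ 2 + r * s by ring.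
  apply: addr_ge0; last exact: mulr_ge0.
  by rewrite real_exprn_even_ge0// realB// ger0_real.
by rewrite partial_sumD lerD.
Qed.

Lemma hs_inner_lim (x y : hilbert_sum) (l : C) :
  partial_sum (fun i => inner (x i) (y i) : C^o) @ totally --> (l : C^o) ->
  hs_inner x y = l.
Proof. by move=> h; apply: (cvg_lim _ h); exact: norm_hausdorff. Qed.

Let hs_inner_linear z : scalar (hs_inner ^~ z).
Proof.
move=> a x y; apply: hs_inner_lim.
have h := cvgD (FF := totally_filter)
  (cvgZl_tmp (FF := totally_filter) (k := a) (@hs_inner_cvg x z)) (@hs_inner_cvg y z).
apply: cvg_trans h; apply: near_eq_cvg; apply: nearW => J.
rewrite fctE/= -[X in X + _]partial_sumZ -partial_sumD.
by congr (partial_sum _ _); apply/funext => i /=; rewrite innerDl innerZl.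
Qed.

Let hs_inner_sym x y : hs_inner x y = (hs_inner y x)^*.
Proof.
apply: hs_inner_lim; apply/cvgrPdist_lt => e e0.
have /cvgrPdist_lt/(_ e e0) := @hs_inner_cvg y x.
apply: filterS => J; congr (_ < _).
rewrite -norm_conjC rmorphB/= rmorph_sum/=; congr `|_ - _|.
by apply: eq_bigr => i _; rewrite -inner_sym.
Qed.

Lemma hs_innerP (x : hilbert_sum) :
  (forall J, partial_sum (fun i => `|x i| ^+ 2) J <= hs_inner x x) /\
  (forall N : C, (forall J, partial_sum (fun i => `|x i| ^+ 2) J <= N) ->
     hs_inner x x <= N).
Proof.
have [M xM] := hs_summable x.
have [|l [hl l1 l2]] := @nonneg_cvg R I (fun i => `|x i| ^+ 2) M _ xM.
  by move=> i; rewrite exprn_ge0.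
rewrite (@hs_inner_lim x x l)//.
by under eq_fun do rewrite inner_norm.
Qed.

Let hs_inner_gt0 (x : hilbert_sum) : x != 0 -> 0 < hs_inner x x.
Proof.
move=> x0; have [i xi] : exists i, x i != 0.
  apply: contrapT => h; move/eqP: x0; apply; apply: hs_ext => i /=.
  by apply/eqP/negPn/negP => xi; apply: h; exists i.
have [h _] := hs_innerP x; apply: lt_le_trans (h [fset i]%fset).
by rewrite partial_sumE big_seq_fset1 exprn_gt0// normr_gt0.
Qed.

Let hs_inner_bilinear : bilinear_for *%R (Num.conj \; *%R) hs_inner.
Proof.
split=> [z a x y|z a x y] /=; first exact: hs_inner_linear.
by rewrite hs_inner_sym hs_inner_linear rmorphD rmorphM/= -!hs_inner_sym.
Qed.

HB.instance Definition _ := bilinear_isBilinear.Build C hilbert_sum hilbert_sum C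
  *%R (Num.conj \; *%R) hs_inner hs_inner_bilinear.

Let hs_inner_hermitian x y : hs_inner x y = (-1) ^+ false * (hs_inner y x)^*.
Proof. by rewrite mul1r hs_inner_sym. Qed.

HB.instance Definition _ := isHermitianSesquilinear.Build C hilbert_sum false
  Num.conj hs_inner hs_inner_hermitian.

HB.instance Definition _ := isDotProduct.Build C hilbert_sum hs_inner hs_inner_gt0.

Definition hs_norm (x : hilbert_sum) : C := sqrtC (hs_inner x x).

Let hs_normD x y : hs_norm (x + y) <= hs_norm x + hs_norm y.
Proof. exact: (dot_triangle hs_inner). Qed.

Let hs_normZ a x : hs_norm (a *: x) = `|a| * hs_norm x.
Proof.
have x0 : 0 <= hs_inner x x by exact: (dnorm_ge0 hs_inner).
by rewrite /hs_norm (dnormZ hs_inner) sqrtCM ?nnegrE ?exprn_ge0// sqrCK.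
Qed.

Let hs_norm_eq0 x : hs_norm x = 0 -> x = 0.
Proof. by move/eqP; rewrite (sqrt_dnorm_eq0 hs_inner) => /eqP. Qed.

HB.instance Definition _ :=
  Lmodule_isNormed.Build C hilbert_sum hs_normD hs_normZ hs_norm_eq0.

Let hs_norm2 (x : hilbert_sum) : hs_inner x x = `|x| ^+ 2.
Proof. by rewrite (_ : `|x| = hs_norm x)// sqrtCK. Qed.

Let hs_norm_le (x : hilbert_sum) (e : C) : 0 <= e ->
  (forall J, partial_sum (fun i => `|x i| ^+ 2) J <= e ^+ 2) -> `|x| <= e.
Proof.
move=> e0 h; rewrite -ler_sqr ?nnegrE// -hs_norm2.
by have [_] := hs_innerP x; exact.
Qed.

Let hs_norm_ge (x : hilbert_sum) J : partial_sum (fun i => `|x i| ^+ 2) J <= `|x| ^+ 2.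
Proof. by rewrite -hs_norm2; have [] := hs_innerP x. Qed.

Let hs_proj_le (x : hilbert_sum) i : `|x i| <= `|x|.
Proof.
rewrite -ler_sqr ?nnegrE//; have := hs_norm_ge x [fset i]%fset.
by rewrite partial_sumE big_seq_fset1.
Qed.

Let hs_complete (F : set_system hilbert_sum) : ProperFilter F -> cauchy F -> cvg F.
Proof.
move=> FF Fc.
have cF (e : C) : 0 < e -> exists2 A, F A & forall x y, A x -> A y -> `|x - y| <= e.
  move=> e0; have e2 : 0 < e / 2 by rewrite divr_gt0.
  have /cauchyP/(_ _ e2)[x Fx] := Fc.
  exists (ball x (e / 2)) => // y z.
  rewrite -ball_normE /ball_ /= => xy xz.
  rewrite (_ : y - z = (x - z) - (x - y)); last first.
    by rewrite opprB [RHS]addrC addrA subrK.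
  by rewrite (le_trans (ler_normB _ _))// [e]splitr lerD// ltW.
have Ci i : exists l : H i, (x i @[x --> F]) --> l.
  apply/cvg_ex; apply/cauchy_cvgP; apply: cauchy_exP => e e0.
  have e2 : 0 < e / 2 by rewrite divr_gt0.
  have [A FA hA] := cF _ e2.
  have [x Ax] := filter_ex FA.
  exists (x i); apply: (@filterS _ F _ A) => // y Ay.
  change (ball (x i) e (y i)).
  rewrite -ball_normE /ball_ /=.
  apply: (@le_lt_trans _ _ `|x - y|); first exact: (hs_proj_le (x - y) i).
  apply: le_lt_trans (hA _ _ Ax Ay) _.
  by rewrite gtr_pMr// invf_lt1// ltr1n.
pose g i := projT1 (cid (Ci i)).
have gP i : (x i @[x --> F]) --> g i by rewrite /g; case: cid.
have key (e : C) A : 0 < e -> F A -> (forall x y, A x -> A y -> `|x - y| <= e) ->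
    forall x, A x -> forall J, partial_sum (fun i => `|x i - g i| ^+ 2) J <= (2 * e) ^+ 2.
  move=> e0 FA hA x Ax J.
  pose d := e / #|{: J}|.+1%:R.
  have d0 : 0 < d by rewrite divr_gt0// ltr0n.
  have [y [Ay hy]] : exists y, A y /\ forall i, i \in J -> `|y i - g i| <= d.
    have : F (A `&` \bigcap_(i in [set` J])
        [set y : hilbert_sum | `|y i - g i| <= d]).
      apply: filterI => //; apply: (@filter_bigI _ _ J (fun i => [set y : hilbert_sum | `|y i - g i| <= d])) => i _.
      have /cvgrPdist_le/(_ _ d0) := gP i.
      by apply: (@filterS _ F) => y /=; rewrite distrC.
    by move=> /filter_ex[y [Ay hy]]; exists y.
  apply: (@le_trans _ _ (partial_sum (fun i => 2 *: (`|x i - y i| ^+ 2 : C^o)) J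
      + \sum_(i : J) (2 * d ^+ 2))).
    rewrite -big_split/=; apply: ler_sum => i _.
    rewrite (_ : x (val i) - g (val i) =
      (x (val i) - y (val i)) + (y (val i) - g (val i))); last first.
      by rewrite addrA subrK.
    apply: (@le_trans _ _ ((`|x (val i) - y (val i)| + `|y (val i) - g (val i)|) ^+ 2)).
      by rewrite ler_sqr ?nnegrE ?addr_ge0// ler_normD.
    apply: le_trans (sqD _ _) _ => //; rewrite lerD2l ler_pM2l//.
    by rewrite ler_sqr ?nnegrE ?(ltW d0)// hy// (valP i).
  rewrite partial_sumZ (_ : (2 * e) ^+ 2 = 2 * e ^+ 2 + 2 * e ^+ 2); last by ring.
  apply: lerD.
    rewrite ler_pM2l//; apply: le_trans (hs_norm_ge (x - y) J) _.
    by rewrite ler_sqr ?nnegrE ?(ltW e0)// hA.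
  rewrite sumr_const -mulrnAr ler_pM2l// /d expr_div_n -[_ *+ #|_|]mulr_natr.
  rewrite mulrAC ler_pdivrMr ?exprn_gt0 ?ltr0n// ler_pM2l ?exprn_gt0//.
  rewrite -natrX ler_nat (@leq_trans #|{: J}|.+1)//.
  by rewrite -[leqLHS]expn1 leq_pexp2l.
have sg : square_summable g.
  have [A FA hA] := cF 1 ltr01.
  have [x Ax] := filter_ex FA.
  have sxg : square_summable (fun i => x i - g i).
    by exists ((2 * 1) ^+ 2) => J; exact: key hA _ Ax J.
  rewrite (_ : g = fun i => x i + - (x i - g i)).
    exact: (ssD (hs_summable x) (ssN sxg)).
  by apply: functional_extensionality_dep => i; rewrite opprB addrC subrK.
apply/cvg_ex; exists (HilbertSum sg); apply/cvgrPdist_le => e e0.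
have e2 : 0 < e / 2 by rewrite divr_gt0.
have [A FA hA] := cF _ e2.
apply: (@filterS _ F _ A) => // x Ax; rewrite distrC.
apply: hs_norm_le; first exact: ltW.
move=> J; apply: le_trans (key _ _ e2 FA hA _ Ax J) _.
by rewrite mulrC divfK ?pnatr_eq0.
Qed.

HB.instance Definition _ := Uniform_isComplete.Build hilbert_sum hs_complete.

HB.instance Definition _ := isHilbert.Build R hilbert_sum
  hs_inner_linear hs_inner_sym hs_norm2.

End HilbertSum.

Section HilbertNotions.
Variable R : realType.
Implicit Types H K : hilbertType R.

(* For bounded [A] there is exactly one such vector, by the Riesz representation
   theorem. *)
Definition adjoint H (A : H -> H) (y : H) : H :=
  xget 0 [set z | forall x, inner (A x) y = inner x z].

Definition is_projection H (P : H -> H) :=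
  (forall x, P (P x) = P x) /\ (forall x y, inner (P x) y = inner x (P y)).

Definition op_le H (A B : H -> H) := forall x, 0 <= inner (B x - A x) x.

Definition is_isometry H K (A : H -> K) := forall x, `|A x| = `|x|.

Definition linear_span H (A : set H) : set H :=
  [set x | exists n (c : 'I_n -> R[i]) (a : 'I_n -> H),
     (forall i, A (a i)) /\ x = \sum_i c i *: a i].

(* [projection_onto P M]: [P] is the orthogonal projection onto the closed
   subspace [M]. *)
Definition projection_onto H (P : H -> H) (M : set H) :=
  forall x, M (P x) /\ forall y, M y -> inner (x - P x) y = 0.

(* [(xi t)_(t in D)] is an orthonormal basis of [H]; values of [xi] outside [D]
   are irrelevant. *)
Definition is_onb H (T : Type) (D : set T) (xi : T -> H) :=
  [/\ forall t, D t -> inner (xi t) (xi t) = 1,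
      forall t u, D t -> D u -> t <> u -> inner (xi t) (xi u) = 0 &
      closure (linear_span (xi @` D)) = setT].

(* The direct limit, in the category of Hilbert spaces and isometries, of the
   sequence [H_ 0 -> H_ 1 -> ...] of isometries [J]. *)
Definition is_hilbert_limit (H_ : nat -> hilbertType R)
    (J : forall n, {linear H_ n -> H_ n.+1}) H (K_ : forall n, {linear H_ n -> H}) :=
  [/\ forall n, is_isometry (K_ n),
      forall n x, K_ n.+1 (J n x) = K_ n x &
      closure (\bigcup_n range (K_ n)) = setT].

End HilbertNotions.

Record digraph := Digraph {
  vert : countType ;
  edge : countType ;
  src : edge -> vert ;
  rng : edge -> vert }.

(* The path [e_n ... e_1] with source [v] is encoded by [v] together with the
   list [:: e_n; ...; e_1]; the vertex [v] is the empty list with source [v]. *)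
Section Paths.
Variable G : digraph.
Implicit Types (v : vert G) (mu w : seq (edge G)).

Definition path_rng v mu := if mu is e :: _ then rng e else v.

Fixpoint is_path v mu : bool :=
  if mu is e :: mu' then (src e == path_rng v mu') && is_path v mu' else true.

Definition is_cycle v w :=
  [&& (0 < size w)%N, is_path v w & path_rng v w == v].

(* The edges of [w = e_k ... e_1] in the order [e_1, ..., e_k]: with indices
   starting from 0, [cycle_edge j] is [e_(j+1)]. *)
Definition cycle_edge w (j : 'I_(size w)) : edge G :=
  tnth (rev_tuple (in_tuple w)) j.

(* [tau n] is [e_(-n-1)], and [ipath_vert tau n] is [v_(-n)]. *)
Definition is_ipath (tau : nat -> edge G) :=
  forall n, src (tau n) = rng (tau n.+1).

Definition ipath_vert (tau : nat -> edge G) n :=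
  if n is m.+1 then src (tau m) else rng (tau 0).

End Paths.

Section Families.
Variables (R : realType) (G : digraph).
Implicit Types H K : hilbertType R.

Record op_family H := OpFamily {
  fam_v : vert G -> {linear H -> H} ;
  fam_e : edge G -> {linear H -> H} ;
  fam_v_continuous : forall v, continuous (fam_v v) ;
  fam_e_continuous : forall e, continuous (fam_e e) }.

(* [S_mu] for the path [mu] with source [v]. *)
Definition fam_path H (S : op_family H) v (mu : seq (edge G)) : H -> H :=
  if mu is [::] then fam_v S v else foldr (fun e A => fam_e S e \o A) id mu.

Record is_tck H (S : op_family H) : Prop := IsTCK {
  tck_projection : forall v, is_projection (fam_v S v) ;
  tck_orthogonal : forall u v, u != v -> forall x, fam_v S u (fam_v S v x) = 0 ;
  tck_source : forall e x, adjoint (fam_e S e) (fam_e S e x) = fam_v S (src e) x ;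
  tck_range : forall v (F : {fset edge G}), (forall e, e \in F -> rng e = v) ->
    op_le (fun x => \sum_(e <- F) fam_e S e (adjoint (fam_e S e) x)) (fam_v S v) }.

Definition is_nondegenerate H (S : op_family H) :=
  forall x : H, partial_sum (fun v => fam_v S v x) @ totally --> x.

Record is_atomic_for H (S : op_family H) (X : Type) (Lam : vert G -> set X)
    (xi : vert G -> X -> H) (pi : edge G -> X -> X) : Prop := IsAtomicFor {
  atomic_disjoint : forall u v, u != v -> Lam u `&` Lam v = set0 ;
  atomic_onb : is_onb [set p | Lam p.1 p.2] (fun p => xi p.1 p.2) ;
  atomic_maps : forall e i, Lam (src e) i -> Lam (rng e) (pi e i) ;
  atomic_inj : forall e i j, Lam (src e) i -> Lam (src e) j ->
    pi e i = pi e j -> i = j ;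
  atomic_vertex : forall v,
    projection_onto (fam_v S v) (closure (linear_span (xi v @` Lam v))) ;
  atomic_edge : forall e i, Lam (src e) i ->
    exists lam : R[i], `|lam| = 1 /\
      fam_e S e (xi (src e) i) = lam *: xi (rng e) (pi e i) ;
  atomic_edge0 : forall e v i, v != src e -> Lam v i -> fam_e S e (xi v i) = 0 ;
  atomic_ranges : forall e f, e != f -> rng e = rng f ->
    (pi e @` Lam (src e)) `&` (pi f @` Lam (src f)) = set0 }.

Definition is_atomic H (S : op_family H) :=
  exists (X : Type) (Lam : vert G -> set X) (xi : vert G -> X -> H)
    (pi : edge G -> X -> X), is_atomic_for S Lam xi pi.

(* [S] is the family L_(G,v) on the Hilbert space [H] with orthonormal basis
   [xi mu], [mu] a path with source [v]. *)
Record is_left_regular_on H (S : op_family H) (v : vert G)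
    (xi : seq (edge G) -> H) : Prop := IsLeftRegularOn {
  lreg_onb : is_onb [set mu | is_path v mu] xi ;
  lreg_vertex : forall u mu, is_path v mu ->
    fam_v S u (xi mu) = if path_rng v mu == u then xi mu else 0 ;
  lreg_edge : forall e mu, is_path v mu ->
    fam_e S e (xi mu) = if src e == path_rng v mu then xi (e :: mu) else 0 }.

Definition is_left_regular H (S : op_family H) (v : vert G) :=
  exists xi, is_left_regular_on S v xi.

(* The space [H_ n], the family [L_ n] and the isometries [J n], [K_ n] are the
   ones usually indexed by [i = - n]. *)
Definition is_inductive H (S : op_family H) (tau : nat -> edge G) :=
  exists (H_ : nat -> hilbertType R) (L_ : forall n, op_family (H_ n))
    (xi : forall n, seq (edge G) -> H_ n)
    (J : forall n, {linear H_ n -> H_ n.+1}) (K_ : forall n, {linear H_ n -> H}),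
  [/\ forall n, is_left_regular_on (L_ n) (ipath_vert tau n) (xi n),
      forall n, is_isometry (J n) /\
        forall mu, is_path (ipath_vert tau n) mu ->
          J n (xi n mu) = xi n.+1 (rcons mu (tau n)),
      is_hilbert_limit J K_ &
      forall v mu, is_path v mu -> forall n x,
        fam_path S v mu (K_ n x) = K_ n (fam_path (L_ n) v mu x)].

(* Index set of the vectors [xi_(j,f,mu)] in the space of a cycle type family. *)
Definition cycle_index (w : seq (edge G)) (j : 'I_(size w)) (f : edge G)
    (mu : seq (edge G)) :=
  [/\ f != cycle_edge j, src f = src (cycle_edge j) & is_path (rng f) mu].

Record is_cycle_type_on H (S : op_family H) (w : seq (edge G)) (lam : R[i])
    (xi : 'I_(size w) -> H) (eta : 'I_(size w) -> edge G -> seq (edge G) -> H) :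
    Prop := IsCycleTypeOn {
  cyc_onb : is_onb
    [set b : 'I_(size w) + 'I_(size w) * edge G * seq (edge G) |
       match b with inl _ => True | inr (j, f, mu) => cycle_index j f mu end]
    (fun b => match b with inl j => xi j | inr (j, f, mu) => eta j f mu end) ;
  cyc_vertex : forall v j,
    fam_v S v (xi j) = if v == src (cycle_edge j) then xi j else 0 ;
  cyc_vertex_branch : forall v j f mu, cycle_index j f mu ->
    fam_v S v (eta j f mu) = if v == path_rng (rng f) mu then eta j f mu else 0 ;
  cyc_next : forall j j' : 'I_(size w), val j' = (val j).+1 ->
    fam_e S (cycle_edge j) (xi j) = xi j' ;
  cyc_last : forall j j' : 'I_(size w), (val j).+1 = size w -> val j' = 0%N ->
    fam_e S (cycle_edge j) (xi j) = lam *: xi j' ;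
  cyc_leave : forall j e, e != cycle_edge j -> src e = src (cycle_edge j) ->
    fam_e S e (xi j) = eta j e [::] ;
  cyc_edge0 : forall j e, src e != src (cycle_edge j) -> fam_e S e (xi j) = 0 ;
  cyc_edge_branch : forall e j f mu, cycle_index j f mu ->
    fam_e S e (eta j f mu) =
      if src e == path_rng (rng f) mu then eta j f (e :: mu) else 0 }.

Definition is_cycle_type H (S : op_family H) (w : seq (edge G)) (lam : R[i]) :=
  exists xi eta, @is_cycle_type_on H S w lam xi eta.

(* [S] is the direct sum of the families [T i], acting componentwise on the
   Hilbert direct sum. *)
Definition is_direct_sum (I : choiceType) (K : I -> hilbertType R)
    (T : forall i, op_family (K i)) (S : op_family (hilbert_sum K)) :=
  (forall v (x : hilbert_sum K) i, fam_v S v x i = fam_v (T i) v (x i)) /\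
  (forall e (x : hilbert_sum K) i, fam_e S e x i = fam_e (T i) e (x i)).

Definition unitarily_equivalent H K (S : op_family H) (T : op_family K) :=
  exists U : {linear H -> K},
    [/\ is_isometry U,
        (forall y, exists x, U x = y),
        (forall v x, U (fam_v S v x) = fam_v T v (U x)) &
        (forall e x, U (fam_e S e x) = fam_e T e (U x))].

End Families.

(* Main.v *)
(** Up to scalars, the edges act on the atomic basis by a partial action in which every
    basis vector has at most one predecessor. Say that two basis vectors are in the same
    class if they have a common ancestor. The closed spans of the classes are invariant,
    pairwise orthogonal and jointly total, so [S] is the direct sum of its restrictions
    to them. Following predecessors inside a class either stops, at a root all of whose
    descendants are distinct (left regular type), or enters a cycle, a shortest one of
    which gives [w] (cycle type), or goes on forever without repetition, the class then
    being an increasing union of trees of descendants (inductive type). Taking as new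
    basis the vectors [S_mu x], for a fixed root vector [x], removes all phases except
    the total phase [lambda] around a cycle. *)
From HB Require Import structures.
Require Import Defs.
From mathcomp Require Import all_boot all_order all_algebra finmap.
From mathcomp Require Import complex.
From mathcomp Require Import boolp classical_sets functions reals topology normedtype.
From mathcomp Require Import summability.
Set Implicit Arguments.
Unset Strict Implicit.
Unset Printing Implicit Defensive.
Import Order.TTheory GRing.Theory Num.Theory numFieldNormedType.Exports.
Local Open Scope ring_scope.
Local Open Scope classical_set_scope.

Identity Coercion set_to_pred : set >-> Funclass.

(** * Closures, continuity and isometries in normed spaces *)

Section NormedFacts.
Variable R : realType.
Local Notation C := R[i].

Lemma closure_normP (V : normedModType C) (A : set V) (x : V) :
  closure A x <-> forall e : C, 0 < e -> exists2 y, A y & `|x - y| < e.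
Proof.
split=> [Ax e e0|h B /nbhs_ballP[e /= e0 eB]].
  have [y [Ay]] := Ax _ (nbhsx_ballx x e e0).
  by rewrite -ball_normE /= => xy; exists y.
have [y Ay xy] := h e e0; exists y; split=> //.
by apply: eB; rewrite -ball_normE.
Qed.

Lemma isometry_continuous (V W : normedModType C) (f : {linear V -> W}) :
  (forall x, `|f x| = `|x|) -> continuous f.
Proof.
move=> fi x; apply/cvgrPdist_lt => e e0.
apply/nbhs_ballP; exists e => //= y.
by rewrite -ball_normE /= -linearB fi.
Qed.

Lemma lipschitz_linear_continuous (V W : normedModType C) (f : {linear V -> W}) (c : C) :
  (forall x, `|f x| <= c * `|x|) -> continuous f.
Proof.
move=> fc; apply: bounded_linear_continuous; apply/bounded_funP => r.
exists (`|c| * r) => x xr.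
(* The sign of [c] is not given, hence the passage to its modulus; [c * |x|] itself is nonnegative
   because it bounds [|f x|]. *)
apply: (@le_trans _ _ (`|c| * `|x|)); last by rewrite ler_wpM2l.
by rewrite -[X in _ * X]normr_id -normrM ger0_norm// (le_trans _ (fc x)).
Qed.

Lemma continuous_linear_le (V W : normedModType C) (f : {linear V -> W}) :
  continuous f -> exists c : C, forall x, `|f x| <= c * `|x|.
Proof.
move=> fc; have /linear_boundedP : bounded_near f (nbhs (0 : V)).
  by apply: continuous_linear_bounded; exact: fc.
by move=> /pinfty_ex_gt0[r r0 h]; exists r.
Qed.

(** As [f] is isometric, the sets [B e] of points sent within [e] of [y] generate a Cauchy filter;
    by completeness of [V] it has a limit, which [f] sends to [y]. *)
Lemma isometry_closed_range (V : completeNormedModType C) (W : normedModType C)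
    (f : {linear V -> W}) :
  (forall x, `|f x| = `|x|) -> closed (range f).
Proof.
move=> fi y /closure_normP cy.
pose D := [set e : C | 0 < e].
pose B (e : C) := [set x | `|y - f x| < e].
have FF : ProperFilter (filter_from D B).
  apply: filter_from_proper; last first.
    by move=> e e0; have [_ [x _ <-] yx] := cy e e0; exists x.
  apply: filter_from_filter; first by exists 1; exact: ltr01.
  move=> a b a0 b0.
  (* The order of [R[i]] is partial, but positive elements are real and hence comparable. *)
  have ab : (a >=< b)%O.
    by apply: real_comparable; rewrite gtr0_real.
  exists (Order.min a b); first by rewrite /D /= comparable_lt_min// a0.
  by move=> x; rewrite /B /= comparable_lt_min// => /andP[].
have /cauchy_cvgP/cvg_ex[x Fx] : cauchy (filter_from D B).
  apply: cauchy_exP => e e0.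
  have e2 : 0 < e / 2 by rewrite divr_gt0.
  have [_ [x _ <-] yx] := cy _ e2; exists x.
  exists (e / 2) => // z; rewrite /B /= => yz.
  rewrite -ball_normE /= -fi linearB /=.
  rewrite (_ : f x - f z = (y - f z) - (y - f x)); last first.
    by rewrite opprB [RHS]addrC addrA subrK.
  by rewrite (le_lt_trans (ler_normB _ _))// [e]splitr ltrD.
exists x => //.
have fx : f z @[z --> filter_from D B] --> f x.
  by apply: continuous_cvg => //; exact: isometry_continuous.
apply: (cvg_unique (@norm_hausdorff _ W) fx).
apply/cvgrPdist_lt => e e0; exists e => //.
Qed.

End NormedFacts.

(** * Closed subspaces as Hilbert spaces, and closed linear spans *)

Section ClosedSubspaces.
Variables (R : realType) (H : hilbertType R).
Local Notation C := R[i].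

Record closed_subspace := ClosedSubspace {
  cs_set :> set H ;
  cs0 : cs_set 0 ;
  csP : forall (a : C) x y, cs_set x -> cs_set y -> cs_set (a *: x + y) ;
  cs_closed : closed cs_set }.

Section CsTheory.
Variable M : closed_subspace.

Lemma csD x y : M x -> M y -> M (x + y).
Proof. by move=> Mx My; rewrite -[x]scale1r; exact: csP. Qed.

Lemma csZ a x : M x -> M (a *: x).
Proof. by move=> Mx; rewrite -[_ *: _]addr0; apply: csP => //; exact: cs0. Qed.

Lemma csN x : M x -> M (- x).
Proof. by move=> Mx; rewrite -scaleN1r; exact: csZ. Qed.

Record cs_type := CsVec { cs_val : H ; cs_in : M cs_val }.

HB.instance Definition _ := gen_eqMixin cs_type.
HB.instance Definition _ := gen_choiceMixin cs_type.

Lemma cs_inj : injective cs_val.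
Proof.
by move=> [x Mx] [y My] /= xy; case: _ / xy My => My; congr CsVec; exact: Prop_irrelevance.
Qed.

Definition cs_zero := CsVec (cs0 M).
Definition cs_opp (x : cs_type) := CsVec (csN (cs_in x)).
Definition cs_add (x y : cs_type) := CsVec (csD (cs_in x) (cs_in y)).
Definition cs_scale (a : C) (x : cs_type) := CsVec (csZ a (cs_in x)).

Let cs_addA : associative cs_add.
Proof. by move=> x y z; apply: cs_inj => /=; rewrite addrA. Qed.
Let cs_addC : commutative cs_add.
Proof. by move=> x y; apply: cs_inj => /=; rewrite addrC. Qed.
Let cs_add0 : left_id cs_zero cs_add.
Proof. by move=> x; apply: cs_inj => /=; rewrite add0r. Qed.
Let cs_addN : left_inverse cs_zero cs_opp cs_add.
Proof. by move=> x; apply: cs_inj => /=; rewrite addNr. Qed.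

HB.instance Definition _ :=
  GRing.isZmodule.Build cs_type cs_addA cs_addC cs_add0 cs_addN.

Let cs_scaleA a b x : cs_scale a (cs_scale b x) = cs_scale (a * b) x.
Proof. by apply: cs_inj => /=; rewrite scalerA. Qed.
Let cs_scale1 : left_id 1 cs_scale.
Proof. by move=> x; apply: cs_inj => /=; rewrite scale1r. Qed.
Let cs_scaleDr : right_distributive cs_scale +%R.
Proof. by move=> a x y; apply: cs_inj => /=; rewrite scalerDr. Qed.
Let cs_scaleDl x : {morph cs_scale^~ x : a b / a + b}.
Proof. by move=> a b; apply: cs_inj => /=; rewrite scalerDl. Qed.

HB.instance Definition _ := GRing.Zmodule_isLmodule.Build C cs_type
  cs_scaleA cs_scale1 cs_scaleDr cs_scaleDl.

Let cs_val_linear : linear cs_val. Proof. by []. Qed.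

HB.instance Definition _ :=
  GRing.isLinear.Build C cs_type H *:%R cs_val cs_val_linear.

Definition cs_norm (x : cs_type) : C := `|cs_val x|.

Let cs_normD x y : cs_norm (x + y) <= cs_norm x + cs_norm y.
Proof. exact: ler_normD. Qed.
Let cs_normZ a x : cs_norm (a *: x) = `|a| * cs_norm x.
Proof. exact: normrZ. Qed.
Let cs_norm_eq0 x : cs_norm x = 0 -> x = 0.
Proof. by move=> /normr0_eq0 h; exact: cs_inj. Qed.

HB.instance Definition _ :=
  Lmodule_isNormed.Build C cs_type cs_normD cs_normZ cs_norm_eq0.

Lemma cs_val_isometry (x : cs_type) : `|cs_val x| = `|x|.
Proof. by []. Qed.

Let cs_complete (F : set_system cs_type) : ProperFilter F -> cauchy F -> cvg F.
Proof.
move=> FF Fc.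
have /cauchy_cvgP/cvg_ex[l Fl] : cauchy (cs_val x @[x --> F]).
  apply: cauchy_exP => e e0.
  have /cauchyP/(_ _ e0)[x Fx] := Fc.
  exists (cs_val x); apply: (@filterS _ F) Fx => y.
  by rewrite -!ball_normE.
have Ml : M l.
  apply: (closed_cvg _ (@cs_closed M) _ _ Fl).
  by near=> x; exact: cs_in.
apply/cvg_ex; exists (CsVec Ml); apply/cvgrPdist_lt => e e0.
by have /cvgrPdist_lt/(_ _ e0) := Fl.
Unshelve. all: by end_near. Qed.

HB.instance Definition _ := Uniform_isComplete.Build cs_type cs_complete.

Definition cs_inner (x y : cs_type) : C := inner (cs_val x) (cs_val y).

Let cs_inner_linear z : scalar (cs_inner ^~ z).
Proof. by move=> a x y; exact: inner_linear. Qed.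
Let cs_inner_sym x y : cs_inner x y = (cs_inner y x)^*.
Proof. exact: inner_sym. Qed.
Let cs_inner_norm x : cs_inner x x = `|x| ^+ 2.
Proof. exact: inner_norm. Qed.

HB.instance Definition _ := isHilbert.Build R cs_type
  cs_inner_linear cs_inner_sym cs_inner_norm.

Lemma cs_innerE (x y : cs_type) : inner x y = inner (cs_val x) (cs_val y).
Proof. by []. Qed.

(* Vectors outside [M] are sent to [0]. *)
Definition to_cs (x : H) : cs_type :=
  if pselect (M x) is left Mx then CsVec Mx else 0.

Lemma to_csK x : M x -> cs_val (to_cs x) = x.
Proof. by rewrite /to_cs; case: pselect. Qed.

End CsTheory.

Lemma linear_span_sub (A : set H) : A `<=` linear_span A.
Proof.
move=> x Ax; exists 1%N, (fun=> 1), (fun=> x); split=> //.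
by rewrite big_ord1 scale1r.
Qed.

Lemma linear_span0 (A : set H) : linear_span A 0.
Proof. by exists 0%N, (fun=> 0), (fun=> 0); split; [case|rewrite big_ord0]. Qed.

Lemma linear_spanP (A : set H) a x y :
  linear_span A x -> linear_span A y -> linear_span A (a *: x + y).
Proof.
move=> [n [c [u [Au ->]]]] [m [d [v [Av ->]]]].
exists (n + m)%N, (fun i => match fintype.split i with inl j => a * c j | inr j => d j end),
  (fun i => match fintype.split i with inl j => u j | inr j => v j end); split.
  by move=> i; case: fintype.split.
rewrite big_split_ord /= scaler_sumr; congr (_ + _); apply: eq_bigr => i _.
  by rewrite (unsplitK (inl i)) scalerA.
by rewrite (unsplitK (inr i)).
Qed.

Lemma linear_span_min (A N : set H) : N 0 ->
  (forall a x y, N x -> N y -> N (a *: x + y)) -> A `<=` N -> linear_span A `<=` N.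
Proof.
move=> N0 NP AN _ [n [c [u [Au ->]]]].
elim: n c u Au => [|n IHn] c u Au; first by rewrite big_ord0.
rewrite big_ord_recl; apply: NP; first exact: AN.
by apply: IHn => i; exact: Au.
Qed.

Lemma closure_span_linear (A : set H) a x y : closure (linear_span A) x ->
  closure (linear_span A) y -> closure (linear_span A) (a *: x + y).
Proof.
move=> /closure_normP cx /closure_normP cy; apply/closure_normP => e e0.
have a1 : 0 < `|a| + 1 by rewrite ltr_wpDl.
(* The [+ 1] keeps the divisor positive when [a] is zero. *)
have d0 : 0 < e / 2 / (`|a| + 1) by rewrite !divr_gt0.
have [x' Ax' xx'] := cx _ d0.
have [y' Ay' yy'] := cy _ (divr_gt0 e0 (ltr0Sn _ _) : 0 < e / 2).
exists (a *: x' + y'); first exact: linear_spanP.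
rewrite opprD addrACA -scalerBr (le_lt_trans (ler_normD _ _))//.
rewrite [e]splitr ler_ltD// normrZ.
apply: (@le_trans _ _ ((`|a| + 1) * `|x - x'|)).
  by rewrite ler_wpM2r// lerDl.
by rewrite mulrC -ler_pdivlMr// ltW.
Qed.

Definition cspan (A : set H) : closed_subspace :=
  ClosedSubspace (@subset_closure _ _ _ (linear_span0 A)) (@closure_span_linear A)
    (@closed_closure _ _).

Lemma cspan_sub (A : set H) : A `<=` cspan A.
Proof. by move=> x Ax; apply: subset_closure; exact: linear_span_sub. Qed.

(** Serves as the induction principle for closed spans: a property that cuts out a closed subspace
    need only be checked on generators. *)
Lemma cspan_min (A : set H) (M : closed_subspace) : A `<=` M -> cspan A `<=` M.
Proof.
move=> AM; have MK : closure M = M by apply/esym/closure_id; exact: cs_closed.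
rewrite -[X in _ `<=` X]MK; apply: closureS; apply: linear_span_min => //.
  exact: cs0.
exact: csP.
Qed.

End ClosedSubspaces.

(** * Preimages of closed subspaces, and orthogonality *)

Section Preimage.
Variables (R : realType) (H K : hilbertType R) (f : {linear H -> K}).
Hypothesis fc : continuous f.
Variable M : closed_subspace K.

Let pre0 : (f @^-1` M) 0. Proof. by rewrite /= linear0; exact: cs0. Qed.
Let preP a x y : (f @^-1` M) x -> (f @^-1` M) y -> (f @^-1` M) (a *: x + y).
Proof. by rewrite /= linearP; exact: csP. Qed.
Let pre_closed : closed (f @^-1` M).
Proof. by apply: preimage_closed; [move=> x _; exact: fc|exact: cs_closed]. Qed.

Definition subspace_preimage := ClosedSubspace pre0 preP pre_closed.

End Preimage.

Section InnerFacts.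
Variables (R : realType) (H : hilbertType R).
Local Notation C := R[i].

Lemma inner_le (x y : H) : `|inner x y| <= `|x| * `|y|.
Proof.
rewrite -ler_sqr ?nnegrE ?mulr_ge0// exprMn -!inner_norm.
exact: (dot_CauchySchwarz (@inner R H)).
Qed.

Lemma inner_eq0_sym (x y : H) : inner x y = 0 -> inner y x = 0.
Proof. by move=> h; rewrite inner_sym h rmorph0. Qed.

Lemma innerBl (x y z : H) : inner (x - y) z = inner x z - inner y z.
Proof. by rewrite innerDl -scaleN1r innerZl mulN1r. Qed.

Section Orthogonal.
Variable y : H.
Let N := [set x : H | inner x y = 0].
Let N0 : N 0. Proof. exact: inner0l. Qed.
Let NP a x z : N x -> N z -> N (a *: x + z).
Proof. by rewrite /N /= innerDl innerZl => -> ->; rewrite mulr0 addr0. Qed.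
Let N_closed : closed N.
Proof.
move=> x /closure_normP cx; apply/eqP/negPn/negP => xy0.
have y0 : 0 < `|y|.
  rewrite normr_gt0; apply: contraNneq xy0 => ->.
  by rewrite inner_sym inner0l rmorph0.
(* By Cauchy-Schwarz no point of [N] is closer to [x] than this number. *)
have e0 : 0 < `|inner x y| / `|y| by rewrite divr_gt0// normr_gt0.
have [z Nz] := cx _ e0; rewrite ltr_pdivlMr//.
have := inner_le (x - z) y; rewrite innerBl Nz subr0.
by move=> /le_lt_trans h /h; rewrite ltxx.
Qed.

Definition orthogonal_subspace : closed_subspace H := ClosedSubspace N0 NP N_closed.

End Orthogonal.

(** The vectors orthogonal to a fixed one form a closed subspace, so [cspan_min] extends
    orthogonality first to one span and then to the other. *)
Lemma cspan_orthogonal (A B : set H) :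
  (forall x y, A x -> B y -> inner x y = 0) ->
  forall x y, cspan A x -> cspan B y -> inner x y = 0.
Proof.
move=> AB x y Ax By.
suff h z : A z -> orthogonal_subspace z y.
  have : cspan A `<=` orthogonal_subspace y.
    by apply: cspan_min => z /h /inner_eq0_sym.
  exact.
move=> Az; apply: (@cspan_min _ _ B) By => u Bu.
by apply: inner_eq0_sym; exact: AB.
Qed.

End InnerFacts.

(** * Restriction of bases and operators to a closed subspace *)

Section Restriction.
Variables (R : realType) (H : hilbertType R) (M : closed_subspace H).
Local Notation C := R[i].

(** Density inside [cs_type M] can be tested in [H], since the inclusion [cs_val] preserves
    norms. *)
Lemma dense_in_cspan (A : set H) (Y : set (cs_type M)) :
  M = cspan A :> set H -> A `<=` @cs_val R H M @` linear_span Y ->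
  closure (linear_span Y) = setT.
Proof.
move=> MA AY; apply/seteqP; split=> // x _; apply/closure_normP => e e0.
have : cspan A (cs_val x) by rewrite -MA; exact: cs_in.
move=> /closure_normP/(_ _ e0)[z Az xz].
have [y Yy yz] : (@cs_val R H M @` linear_span Y) z.
  apply: linear_span_min Az => //; first by exists 0 => //; exact: linear_span0.
  move=> a _ _ [u Yu <-] [v Yv <-]; exists (a *: u + v) => //.
  exact: linear_spanP.
by exists y => //; rewrite -cs_val_isometry linearB /= yz.
Qed.

(** Part of an orthonormal basis, selected by [g] and altered by phases [lam], stays orthonormal; it
    spans [M] because the phases can be divided out again. *)
Lemma is_onb_rescale (T T' : Type) (D : set T) (D' : set T') (xi : T -> H)
    (eta : T' -> cs_type M) (g : T' -> T) (lam : T' -> C) :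
  is_onb D xi -> M = cspan (xi @` (g @` D')) :> set H ->
  (forall t, D' t -> [/\ D (g t), `|lam t| = 1 & cs_val (eta t) = lam t *: xi (g t)]) ->
  (forall t u, D' t -> D' u -> g t = g u -> t = u) ->
  is_onb D' eta.
Proof.
move=> [xi1 xi0 _] MA geta ginj; split.
- move=> t /geta[Dgt lam1 et].
  by rewrite cs_innerE et innerZl innerZr xi1// mulr1 -normCK lam1 expr1n.
- move=> t u Dt Du tu.
  have [Dgt _ et] := geta _ Dt; have [Dgu _ eu] := geta _ Du.
  rewrite cs_innerE et eu innerZl innerZr xi0 ?mulr0// => gtu.
  by apply: tu; exact: ginj.
- apply: dense_in_cspan MA _ => _ [_ [t Dt <-] <-].
  have [_ lam1 et] := geta _ Dt.
  exists ((lam t)^-1 *: eta t).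
    rewrite -[_ *: _]addr0; apply: linear_spanP; last exact: linear_span0.
    by apply: linear_span_sub; exists t.
  rewrite linearZ /= et scalerA mulVf ?scale1r//.
  by rewrite -normr_gt0 lam1.
Qed.

Variable f : {linear H -> H}.

Definition cs_restrict_fun (x : cs_type M) := to_cs M (f (cs_val x)).

Hypothesis fM : forall x, M x -> M (f x).

Lemma cs_restrict_val x : cs_val (cs_restrict_fun x) = f (cs_val x).
Proof. by rewrite to_csK//; apply: fM; exact: cs_in. Qed.

Lemma cs_restrict_linear : linear cs_restrict_fun.
Proof.
by move=> a x y; apply: cs_inj; rewrite linearP /= !cs_restrict_val linearP.
Qed.

Definition cs_restrict : {linear cs_type M -> cs_type M} :=
  HB.pack cs_restrict_fun
    (GRing.isLinear.Build C (cs_type M) (cs_type M) *:%R cs_restrict_fun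
       cs_restrict_linear).

Lemma cs_restrict_continuous : continuous f -> continuous cs_restrict.
Proof.
move=> /continuous_linear_le[c fc]; apply: (@lipschitz_linear_continuous _ _ _ _ c) => x.
by rewrite -!cs_val_isometry cs_restrict_val.
Qed.

End Restriction.

Section Inclusion.
Variables (R : realType) (H : hilbertType R) (M N : closed_subspace H) (MN : M `<=` N).

Definition cs_incl_fun (x : cs_type M) : cs_type N := CsVec (MN (cs_in x)).

Let cs_incl_linear : linear cs_incl_fun.
Proof. by move=> a x y; apply: cs_inj. Qed.

HB.instance Definition _ := GRing.isLinear.Build R[i] (cs_type M) (cs_type N) *:%R
  cs_incl_fun cs_incl_linear.

Definition cs_incl : {linear cs_type M -> cs_type N} := cs_incl_fun.

Lemma cs_incl_val x : cs_val (cs_incl x) = cs_val x. Proof. by []. Qed.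

End Inclusion.

(** * Summation of pairwise orthogonal subspaces *)

Section Pythagoras.
Variables (R : realType) (H : hilbertType R) (I : choiceType) (y : I -> H).
Hypothesis orth : forall i j, i <> j -> inner (y i) (y j) = 0.

Lemma inner_sumr (T : Type) (r : seq T) (u : T -> H) z :
  inner z (\sum_(i <- r) u i) = \sum_(i <- r) inner z (u i).
Proof.
apply: (big_morph (fun u => inner z u)) => [a b|]; first exact: innerDr.
by rewrite inner_sym inner0l rmorph0.
Qed.

Lemma pythagoras (r : seq I) : uniq r ->
  `|\sum_(i <- r) y i| ^+ 2 = \sum_(i <- r) `|y i| ^+ 2.
Proof.
elim: r => [|i r IHr] /=; first by rewrite !big_nil normr0 expr0n.
move=> /andP[ir ur]; rewrite !big_cons -IHr// -!inner_norm.
have iz : inner (y i) (\sum_(j <- r) y j) = 0.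
  rewrite inner_sumr big1_seq// => j /= jr; apply: orth => ij.
  by move: ir; rewrite ij jr.
by rewrite innerDl !innerDr iz (inner_eq0_sym iz) addr0 add0r.
Qed.

End Pythagoras.

Section Synthesis.
Variables (R : realType) (H : hilbertType R) (I : choiceType) (M : I -> closed_subspace H).
Local Notation C := R[i].
Local Notation K := (fun i => cs_type (M i)).
Local Notation HS := (hilbert_sum K).
Hypothesis orth : forall i j x y, i <> j -> M i x -> M j y -> inner x y = 0.

Local Notation psum x := (partial_sum (fun i => cs_val (x i))).

Lemma hs_partial_norm (x : forall i, K i) (J : {fset I}) :
  `|psum x J| ^+ 2 = partial_sum (fun i => `|x i| ^+ 2) J.
Proof.
rewrite !partial_sumE pythagoras// => i j ij.
by apply: orth ij _ _; exact: cs_in.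
Qed.

(** Let [l] be the supremum of the sums of squared norms, and let [J0] come within [e ^+ 2] of it.
    For [J] above [J0], the partial sums over [J] and [J0] differ by a sum over the rest of [J],
    whose squared norm is less than [e ^+ 2] by Pythagoras. *)
Lemma hs_partial_cvg (x : HS) : exists l : H, psum x @ totally --> l.
Proof.
have [N xN] := hs_summable x.
have [|l [_ lub least]] := @nonneg_cvg R I (fun i => `|x i| ^+ 2) N _ xN.
  by move=> i; rewrite exprn_ge0.
apply/cvg_ex; apply/(@cauchy_cvgP _ _ (fmap_proper_filter _ totally_filter)).
apply: cauchy_exP => e e0.
have [J0 hJ0] : exists J0, ~~ (partial_sum (fun i => `|x i| ^+ 2) J0 <= l - e ^+ 2).
  apply: contrapT => /forallNP h; have : l <= l - e ^+ 2.
    by apply: least => J; apply/negPn/negP; exact: h.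
  rewrite -subr_ge0 addrAC subrr add0r oppr_ge0.
  by move=> /(lt_le_trans (exprn_gt0 2 e0)); rewrite ltxx.
exists (psum x J0); exists J0 => // J /= J0J.
rewrite -ball_normE /=.
(* Negating [<=] in [R[i]] gives [<] only between real elements. *)
have lR : l \is Num.real.
  rewrite ger0_real//; apply: le_trans (lub fset0).
  by rewrite partial_sumE big_seq_fset0.
have {hJ0} hJ0 : l - partial_sum (fun i => `|x i| ^+ 2) J0 < e ^+ 2.
  move: hJ0; rewrite -real_ltNge; last 2 first.
  - by rewrite realB// ger0_real// exprn_ge0// ltW.
  - by rewrite ger0_real//; apply: sumr_ge0 => i _; rewrite exprn_ge0.
  by rewrite ltrBlDr ltrBlDl.
rewrite -ltr_sqr ?nnegrE ?(ltW e0)//; apply: le_lt_trans hJ0.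
rewrite lerBrDl; apply: le_trans (lub J).
have split_sum (W : zmodType) (a : I -> W) :
    partial_sum a J = partial_sum a J0 + partial_sum a (J `\` J0)%fset.
  rewrite !partial_sumE (big_fsetID _ (mem J0)) /=; congr (_ + _).
    apply: eq_fbigl => i; rewrite !inE /= andbC.
    by case: (boolP (i \in J0)) => //= iJ; rewrite (fsubsetP J0J).
  by apply: eq_fbigl => i; rewrite !inE /= andbC.
by rewrite !split_sum opprD addNKr normrN hs_partial_norm.
Qed.

(** Adds up the components inside [H]; its inverse will be the unitary of the theorem. *)
Definition hs_synth (x : HS) : H := lim (psum x @ totally).

Lemma hs_synth_cvg (x : HS) : psum x @ totally --> hs_synth x.
Proof.
have [l hl] := hs_partial_cvg x.
by rewrite /hs_synth (cvg_lim _ hl)//; exact: norm_hausdorff.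
Qed.

Lemma hs_synth_lim (x : HS) (l : H) : psum x @ totally --> l -> hs_synth x = l.
Proof. by move=> h; apply: (cvg_lim _ h); exact: norm_hausdorff. Qed.

Lemma hs_synth_linear : linear hs_synth.
Proof.
move=> a x y; apply: hs_synth_lim.
have h := cvgD (FF := totally_filter)
  (cvgZl_tmp (FF := totally_filter) (k := a) (@hs_synth_cvg x)) (@hs_synth_cvg y).
apply: cvg_trans h; apply: near_eq_cvg; apply: nearW => J.
by rewrite fctE/= -[X in X + _]partial_sumZ -partial_sumD.
Qed.

HB.instance Definition _ := GRing.isLinear.Build C HS H *:%R hs_synth hs_synth_linear.

(** By Pythagoras the squared norms of the partial sums are the partial sums of [inner x x], so the
    two squared norms are limits of the same net. *)
Lemma hs_synth_isometry (x : HS) : `|hs_synth x| = `|x|.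
Proof.
apply/eqP; rewrite -(@eqrXn2 _ 2)//; apply/eqP.
have h1 : (fun J => `|psum x J| : C^o) @ totally --> (`|hs_synth x| : C^o).
  by apply: (cvg_norm (FF := totally_filter)); exact: hs_synth_cvg.
have h2 := cvgM (FF := totally_filter) h1 h1.
have h3 := @hs_inner_cvg R I K x x.
rewrite -[RHS]inner_norm.
apply: (cvg_unique (FF := fmap_proper_filter _ totally_filter)
  (@norm_hausdorff _ C^o) _ h3).
apply: cvg_trans h2; apply: near_eq_cvg; apply: nearW => J.
rewrite /= -expr2 hs_partial_norm.
by congr (partial_sum _ _); apply/funext => i /=; rewrite inner_norm.
Qed.

(** A vector of [M i] is the image of the element having it as its only nonzero component: the
    partial sums are constant once the finite set contains [i]. *)
Lemma hs_synth_range i : M i `<=` range hs_synth.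
Proof.
move=> y My.
have Pj j : cs_val (to_cs (M j) (if j == i then y else 0)) = if j == i then y else 0.
  by rewrite to_csK//; case: eqP => [->//|_]; exact: cs0.
pose f j := to_cs (M j) (if j == i then y else 0).
have f0 j : j != i -> f j = 0.
  by move=> /negPf ji; apply: cs_inj; rewrite Pj ji.
have fs : @square_summable R I K f.
  exists (`|y| ^+ 2) => J; rewrite partial_sumE.
  have [iJ|iJ] := boolP (i \in J).
    rewrite (big_fsetD1 i)//= big1_fset ?addr0; last first.
      by move=> j; rewrite !inE => /andP[ji _] _; rewrite f0// normr0 expr0n.
    by rewrite -cs_val_isometry Pj eqxx.
  rewrite big1_fset ?exprn_ge0// => j jJ _; rewrite f0 ?normr0 ?expr0n//.
  by apply: contraNneq iJ => <-.
exists (HilbertSum fs) => //; apply: hs_synth_lim.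
apply: (cvg_trans _ (cvg_cst (F := totally) y)).
apply: near_eq_cvg; exists [fset i]%fset => // J /= iJ.
have {}iJ : i \in J by apply: (fsubsetP iJ); rewrite inE.
rewrite partial_sumE (big_fsetD1 i)//= big1_fset ?addr0 ?Pj ?eqxx//.
by move=> j; rewrite !inE => /andP[/negPf ji _] _; rewrite Pj ji.
Qed.

End Synthesis.

(** * Restriction of operator families to stable subspaces *)

Section FamilyRestriction.
Variables (R : realType) (G : digraph) (H : hilbertType R) (S : op_family G H).

Definition fam_stable (M : closed_subspace H) :=
  (forall v x, M x -> M (fam_v S v x)) /\ (forall e x, M x -> M (fam_e S e x)).

Definition fam_restrict (M : closed_subspace H) (SM : fam_stable M) :
    op_family G (cs_type M) :=
  OpFamily (fun v => @cs_restrict_continuous _ _ _ _ (SM.1 v) (@fam_v_continuous R G H S v))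
    (fun e => @cs_restrict_continuous _ _ _ _ (SM.2 e) (@fam_e_continuous R G H S e)).

Lemma fam_restrict_v M (SM : fam_stable M) v x :
  cs_val (fam_v (fam_restrict SM) v x) = fam_v S v (cs_val x).
Proof. exact: (cs_restrict_val (SM.1 v)). Qed.

Lemma fam_restrict_e M (SM : fam_stable M) e x :
  cs_val (fam_e (fam_restrict SM) e x) = fam_e S e (cs_val x).
Proof. exact: (cs_restrict_val (SM.2 e)). Qed.

Lemma fam_restrict_path M (SM : fam_stable M) v mu x :
  cs_val (fam_path (fam_restrict SM) v mu x) = fam_path S v mu (cs_val x).
Proof.
case: mu => [|e mu]; first exact: fam_restrict_v.
rewrite /fam_path; elim: (e :: mu) => //= f nu <-.
exact: fam_restrict_e.
Qed.

(** Generators suffice, because the preimage of a closed subspace under a continuous operator is a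
    closed subspace. *)
Lemma fam_stable_span (A : set H) :
  (forall v x, A x -> cspan A (fam_v S v x)) ->
  (forall e x, A x -> cspan A (fam_e S e x)) -> fam_stable (cspan A).
Proof.
move=> Av Ae; split=> [v|e].
  exact: (@cspan_min _ _ _ (subspace_preimage (@fam_v_continuous R G H S v) (cspan A))
    (Av v)).
exact: (@cspan_min _ _ _ (subspace_preimage (@fam_e_continuous R G H S e) (cspan A))
  (Ae e)).
Qed.

End FamilyRestriction.

(** * A family as the direct sum of its restrictions *)

Section OrthogonalDecomposition.
Variables (R : realType) (G : digraph) (H : hilbertType R) (S : op_family G H).
Variables (I : choiceType) (M : I -> closed_subspace H).
Local Notation C := R[i].
Local Notation K := (fun i => cs_type (M i)).
Local Notation HS := (hilbert_sum K).
Hypothesis orth : forall i j x y, i <> j -> M i x -> M j y -> inner x y = 0.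
Hypothesis total : forall N : closed_subspace H, (forall i, M i `<=` N) -> forall x, N x.
Hypothesis SM : forall i, fam_stable S (M i).

Local Notation V := (@hs_synth R H I M).

(** The range of an isometry on a complete space is closed, and it contains every [M i], so [total]
    applies to it. *)
Lemma hs_synth_surjective y : exists x, V x = y.
Proof.
have r0 : range V 0 by exists 0 => //; rewrite linear0.
have rP (a : C) x z : range V x -> range V z -> range V (a *: x + z).
  by move=> [u _ <-] [w _ <-]; exists (a *: u + w) => //; rewrite linearP.
have rc : closed (range V).
  by apply: isometry_closed_range; exact: hs_synth_isometry.
have [x _ <-] := @total (ClosedSubspace r0 rP rc) (@hs_synth_range R H I M) y.
by exists x.
Qed.

Lemma hs_synth_inj : injective V.
Proof.
move=> x y xy; apply/eqP; rewrite -subr_eq0 -normr_eq0.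
by rewrite -(hs_synth_isometry orth) linearB /= xy subrr normr0.
Qed.

Section Componentwise.
Variable f : {linear H -> H}.
Hypotheses (fc : continuous f) (fM : forall i x, M i x -> M i (f x)).

Let comp (x : HS) i : K i := cs_restrict (@fM i) (x i).

Let comp_summable (x : HS) : square_summable (comp x).
Proof.
(* One bound [c] for [f] serves all components at once. *)
have [c fc'] := continuous_linear_le fc; have [N xN] := hs_summable x.
exists (`|c| ^+ 2 * N) => J.
apply: (@le_trans _ _ (`|c| ^+ 2 * partial_sum (fun i => `|x i| ^+ 2) J)).
  rewrite /partial_sum mulr_sumr; apply: ler_sum => -[i iJ] _ /=; rewrite -exprMn.
  rewrite ler_sqr ?nnegrE ?mulr_ge0// -!cs_val_isometry (cs_restrict_val (@fM i)).
  rewrite -[X in _ * X]normr_id -normrM ger0_norm//.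
  exact: (le_trans _ (fc' _)).
by rewrite ler_wpM2l ?exprn_ge0//; exact: xN.
Qed.

Definition hs_map_fun (x : HS) : HS := HilbertSum (comp_summable x).

Lemma hs_map_linear : linear hs_map_fun.
Proof. by move=> a x y; apply: hs_ext => i; rewrite /= /comp linearP. Qed.

Definition hs_map : {linear HS -> HS} :=
  HB.pack hs_map_fun (GRing.isLinear.Build C HS HS *:%R hs_map_fun hs_map_linear).

Lemma hs_mapE (x : HS) i : hs_map x i = cs_restrict (@fM i) (x i).
Proof. by []. Qed.

Lemma hs_synth_map (x : HS) : V (hs_map x) = f (V x).
Proof.
apply: hs_synth_lim.
have h : f (partial_sum (fun i => cs_val (x i)) J) @[J --> totally] --> f (V x).
  by apply: continuous_cvg; [exact: fc|exact: hs_synth_cvg].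
apply: cvg_trans h; apply: near_eq_cvg; apply: nearW => J.
rewrite /partial_sum linear_sum; apply: eq_bigr => i _.
by rewrite hs_mapE (cs_restrict_val (@fM _)).
Qed.

(** [V] is isometric and intertwines [hs_map] with [f], so the bound of [f] carries over. *)
Lemma hs_map_continuous : continuous hs_map.
Proof.
have [c fc'] := continuous_linear_le fc.
apply: (@lipschitz_linear_continuous _ _ _ _ c) => x.
by rewrite -!(hs_synth_isometry orth) hs_synth_map.
Qed.

End Componentwise.

Definition hs_family : op_family G HS :=
  OpFamily (fun v => @hs_map_continuous _ (@fam_v_continuous R G H S v)
      (fun i => (SM i).1 v))
    (fun e => @hs_map_continuous _ (@fam_e_continuous R G H S e)
      (fun i => (SM i).2 e)).

Lemma hs_family_direct_sum : is_direct_sum (fun i => fam_restrict (SM i)) hs_family.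
Proof. by []. Qed.

Lemma hs_family_equivalent : unitarily_equivalent S hs_family.
Proof.
(* The unitary is the inverse of [V], chosen pointwise; its linearity and the intertwining relations
   are checked after applying the injective map [V]. *)
have [W WK] : {W : H -> HS | cancel W V}.
  by exists (fun y => projT1 (cid (hs_synth_surjective y))) => y; case: cid.
have VK : cancel V W by move=> x; apply: hs_synth_inj; rewrite WK.
have Wlin : linear W.
  by move=> a x y; apply: hs_synth_inj; rewrite (hs_synth_linear orth) !WK.
pose U : {linear H -> HS} :=
  HB.pack W (GRing.isLinear.Build C H HS *:%R W Wlin).
exists U; split.
- by move=> x; rewrite /= -[X in _ = `|X|]WK (hs_synth_isometry orth).
- by move=> y; exists (V y); rewrite /= VK.
- by move=> v x; apply: hs_synth_inj; rewrite /= WK hs_synth_map ?WK//;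
    exact: fam_v_continuous.
- by move=> e x; apply: hs_synth_inj; rewrite /= WK hs_synth_map ?WK//;
    exact: fam_e_continuous.
Qed.

End OrthogonalDecomposition.

(** * Paths, and partial actions with unique predecessors *)

Section PathFacts.
Variable G : digraph.
Implicit Types (v : vert G) (mu nu : seq (edge G)).

Lemma path_rng_cat v mu nu : path_rng v (mu ++ nu) = path_rng (path_rng v nu) mu.
Proof. by case: mu. Qed.

Lemma is_path_cat v mu nu :
  is_path v (mu ++ nu) = is_path v nu && is_path (path_rng v nu) mu.
Proof.
elim: mu => [|e mu IHmu] /=; first by rewrite andbT.
by rewrite IHmu path_rng_cat andbCA.
Qed.

End PathFacts.

(* An atomic family moves its basis vectors, up to scalars, along a partial action
   of the edges on the index set [D] in which predecessors are unique. *)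
Section PartialAction.
Variables (G : digraph) (B : Type) (vtx : B -> vert G) (D : set B).
Variable move : edge G -> B -> B.
Hypothesis move_in : forall e p, D p -> src e = vtx p -> D (move e p).
Hypothesis move_vtx : forall e p, vtx (move e p) = rng e.
Hypothesis move_inj : forall e f p q, D p -> D q -> src e = vtx p -> src f = vtx q ->
  move e p = move f q -> e = f /\ p = q.
Implicit Types (p q r : B) (mu nu : seq (edge G)).

Definition moves mu p := foldr move p mu.

Lemma moves_cat mu nu p : moves (mu ++ nu) p = moves mu (moves nu p).
Proof. exact: foldr_cat. Qed.

Lemma moves_vtx mu p : vtx (moves mu p) = path_rng (vtx p) mu.
Proof. by case: mu => //= e mu; exact: move_vtx. Qed.

Lemma moves_in mu p : D p -> is_path (vtx p) mu -> D (moves mu p).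
Proof.
move=> Dp; elim: mu => //= e mu IHmu /andP[/eqP se /IHmu].
by move=> /move_in; apply; rewrite moves_vtx.
Qed.

Lemma is_path_moves mu nu p :
  is_path (vtx p) nu -> is_path (vtx (moves nu p)) mu -> is_path (vtx p) (mu ++ nu).
Proof. by rewrite is_path_cat moves_vtx => -> ->. Qed.

(** The head of a path is its last edge. Since predecessors are unique, paths with a common end have
    the same last edge and arrive through the same index, so edges can be stripped from both until
    the shorter path is exhausted. *)
Lemma moves_cancel mu nu p q : D p -> D q ->
  is_path (vtx p) mu -> is_path (vtx q) nu -> (size mu <= size nu)%N ->
  moves mu p = moves nu q ->
  exists nu', [/\ nu = mu ++ nu', is_path (vtx q) nu' & p = moves nu' q].
Proof.
move=> Dp Dq; elim: mu nu => [|e mu IHmu] [|f nu] //=.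
- by move=> _ _ _ ->; exists [::].
- by move=> _ pnu _ ->; exists (f :: nu).
move=> /andP[/eqP se pmu] /andP[/eqP sf pnu] s.
case/move_inj; rewrite ?moves_vtx//; [exact: moves_in|exact: moves_in|].
by move=> -> /(IHmu _ pmu pnu s)[nu' [-> pnu' ->]]; exists nu'.
Qed.

Definition acyclic_at r :=
  forall nu, is_path (vtx r) nu -> moves nu r = r -> nu = [::].

Definition descendants r : set B := [set moves mu r | mu in is_path (vtx r)].

Definition same_class p q := exists r mu nu,
  [/\ D r, is_path (vtx r) mu, is_path (vtx r) nu, p = moves mu r & q = moves nu r].

Lemma same_class_refl p : D p -> same_class p p.
Proof. by move=> Dp; exists p, [::], [::]. Qed.

Lemma same_class_sym p q : same_class p q -> same_class q p.
Proof. by move=> [r [mu [nu [? ? ? ? ?]]]]; exists r, nu, mu. Qed.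

(** Of the two ancestors of the middle index, [moves_cancel] shows one to descend from the other;
    the older one is an ancestor of all three indices. *)
Lemma same_class_trans p q r : same_class p q -> same_class q r -> same_class p r.
Proof.
move=> [a [mu [nu [Da pmu pnu -> ->]]]] [b [al [be [Db pal pbe qE ->]]]].
have [s|s] := leqP (size nu) (size al).
  have [al' [alE pal' aE]] := moves_cancel Da Db pnu pal s qE.
  exists b, (mu ++ al'), be; split=> //; last by rewrite moves_cat aE.
  by apply: is_path_moves => //; rewrite -aE.
have [nu' [nuE pnu' bE]] := moves_cancel Db Da pal pnu (ltnW s) (esym qE).
exists a, mu, (be ++ nu'); split=> //; last by rewrite moves_cat bE.
by apply: is_path_moves => //; rewrite -bE.
Qed.

Lemma same_class_in p q : same_class p q -> D q.
Proof. by move=> [r [mu [nu [Dr _ pnu _ ->]]]]; exact: moves_in. Qed.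

Lemma same_class_moves p q mu : same_class p q -> is_path (vtx q) mu ->
  same_class p (moves mu q).
Proof.
move=> [r [al [be [Dr pal pbe -> ->]]]] pmu.
exists r, al, (mu ++ be); split=> //; last by rewrite moves_cat.
exact: is_path_moves.
Qed.

Lemma same_class_anc p q mu : D q -> is_path (vtx q) mu ->
  same_class p (moves mu q) -> same_class p q.
Proof.
move=> Dq pmu pc; apply: same_class_trans pc _.
by exists q, mu, [::].
Qed.

(** After cancellation the excess of the longer path is a loop at [r], hence empty. *)
Lemma acyclic_at_inj r mu nu : D r -> acyclic_at r ->
  is_path (vtx r) mu -> is_path (vtx r) nu -> moves mu r = moves nu r -> mu = nu.
Proof.
move=> Dr fr; wlog s : mu nu / (size mu <= size nu)%N.
  move=> h pmu pnu E; have [s|/ltnW s] := leqP (size mu) (size nu); first exact: h.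
  by apply/esym; exact: h.
move=> pmu pnu /(moves_cancel Dr Dr pmu pnu s)[nu' [-> pnu' /esym/(fr _ pnu') ->]].
by rewrite cats0.
Qed.

Lemma class_of_root r : D r ->
  (forall e q, D q -> src e = vtx q -> move e q <> r) ->
  same_class r = descendants r.
Proof.
move=> Dr root; apply/seteqP; split=> q; last first.
  by move=> [mu pmu <-]; apply: same_class_moves => //; exact: same_class_refl.
move=> [c [[|e mu] [nu [Dc pmu pnu rE ->]]]]; first by rewrite rE; exists nu.
move: pmu => /= /andP[/eqP se pmu]; exfalso.
apply: (root e (moves mu c)); rewrite ?moves_vtx//; exact: moves_in.
Qed.

Lemma class_of_cycle r w : D r -> is_path (vtx r) w -> w <> [::] -> moves w r = r ->
  same_class r = descendants r.
Proof.
move=> Dr pw w0 wr; apply/seteqP; split=> q; last first.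
  by move=> [mu pmu <-]; apply: same_class_moves => //; exact: same_class_refl.
move=> [c [mu [nu [Dc pmu pnu rE ->]]]].
(* Going round [w] often enough gives a loop at [r] at least as long as the path [mu] from the
   common ancestor [c] to [r]; cancelling [mu] then exhibits [c] as a descendant of [r]. *)
have [w' [pw' w'r sw']] : exists w', [/\ is_path (vtx r) w', moves w' r = r &
    (size mu <= size w')%N].
  elim: (size mu) => [|n [w' [pw' w'r sw']]]; first by exists [::].
  exists (w ++ w'); split; first by apply: is_path_moves => //; rewrite w'r.
    by rewrite moves_cat w'r wr.
  rewrite size_cat -addn1 addnC leq_add//.
  by case: (w) w0.
have [w'' [_ pw'' cE]] :=
  moves_cancel Dc Dr pmu pw' sw' (etrans (esym rE) (esym w'r)).
exists (nu ++ w''); last by rewrite moves_cat -cE.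
by apply: is_path_moves => //; rewrite -cE.
Qed.

(** In [ClassRay], [b n.+1] is the predecessor of [b n]. In [ClassCycle], [w] is a shortest nonempty
    loop at [r], so that it goes round only once and the indices along it are distinct. *)
Variant class_spec (A : set B) : Prop :=
| ClassTree r of D r & acyclic_at r & A = descendants r
| ClassRay (b : nat -> B) (tau : nat -> edge G) of
    (forall n, D (b n) /\ acyclic_at (b n)) &
    (forall n, src (tau n) = vtx (b n.+1) /\ move (tau n) (b n.+1) = b n) &
    A = \bigcup_n descendants (b n)
| ClassCycle r w of D r & is_path (vtx r) w & w <> [::] & moves w r = r &
    (forall nu, is_path (vtx r) nu -> nu <> [::] -> moves nu r = r ->
      (size w <= size nu)%N) &
    A = descendants r.

Lemma same_class_classE p q : same_class p q -> same_class p = same_class q.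
Proof.
move=> pq; apply/seteqP; split=> r; last exact: same_class_trans.
by apply: same_class_trans; exact: same_class_sym.
Qed.

Lemma class_of_ray p (b : nat -> B) (tau : nat -> edge G) :
  (forall n, same_class p (b n)) -> b 0%N = p ->
  (forall n, src (tau n) = vtx (b n.+1) /\ move (tau n) (b n.+1) = b n) ->
  same_class p = \bigcup_n descendants (b n).
Proof.
move=> pb b0 bS; apply/seteqP; split=> q; last first.
  by move=> [n _ [mu pmu <-]]; apply: same_class_moves.
(* A common ancestor [c] at distance [n] from [p] must be [b n]: the first [n] edges of [tau] lead
   from [b n] to [p], and cancelling two paths of equal length leaves nothing over. *)
have pathb n : is_path (vtx (b n)) (mkseq tau n) /\ moves (mkseq tau n) (b n) = p.
  elim: n => [|n [pn mn]]; first by rewrite /= b0.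
  rewrite /mkseq -addn1 iotaD map_cat /= -/(mkseq tau n) cats1 -cats1 addn1.
  rewrite add0n moves_cat /= (bS n).2 mn; split=> //.
  by rewrite is_path_cat /= (bS n).1 eqxx -(move_vtx _ (b n.+1)) (bS n).2.
move=> [c [mu [nu [Dc pmu pnu pE ->]]]].
have [pm mm] := pathb (size mu).
have [|al [muE pal cE]] := moves_cancel Dc (same_class_in (pb _)) pmu pm _
  (etrans (esym pE) (esym mm)); first by rewrite size_mkseq.
have al0 : al = [::].
  by have := congr1 size muE; rewrite size_cat size_mkseq -[LHS]addn0 => /addnI; case: (al).
exists (size mu) => //; exists nu; last by rewrite cE al0.
by move: pnu; rewrite cE al0.
Qed.

Lemma same_class_cases p : D p -> class_spec (same_class p).
Proof.
move=> Dp.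
have [[r [w [pr pw w0 wr]]]|noc] := pselect (exists r w,
    [/\ same_class p r, is_path (vtx r) w, w <> [::] & moves w r = r]).
  have Dr := same_class_in pr; rewrite (same_class_classE pr).
  pose Q n := `[< exists w, [/\ is_path (vtx r) w, w <> [::], moves w r = r &
    size w = n] >].
  have exQ : exists n, Q n by exists (size w); apply/asboolP; exists w.
  have [n /asboolP[w' [pw' w'0 w'r <-]] nmin] := ex_minnP exQ.
  apply: (@ClassCycle _ r w') => //; last exact: (class_of_cycle Dr pw w0 wr).
  by move=> nu pnu nu0 nur; apply: nmin; apply/asboolP; exists nu.
have fr q : same_class p q -> acyclic_at q.
  move=> pq nu pnu nuq; apply: contrapT => nu0.
  by apply: noc; exists q, nu.
have [[r [pr root]]|noroot] := pselect (exists r, same_class p r /\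
    forall e q, D q -> src e = vtx q -> move e q <> r).
  have Dr := same_class_in pr; rewrite (same_class_classE pr).
  by apply: (@ClassTree _ r) => //; [exact: fr|exact: class_of_root].
(* Without a root every member of the class has a predecessor, again in the class; the sigma type
   allows a choice of predecessors to be iterated. *)
have exF (s : {q | same_class p q}) : exists et : edge G * {q | same_class p q},
    src et.1 = vtx (sval et.2) /\ move et.1 (sval et.2) = sval s.
  case: s => q pq.
  apply: contrapT => h; apply: noroot; exists q; split=> // e r Dr se er.
  apply: h; suff pr : same_class p r by exists (e, exist _ r pr).
  apply: (@same_class_anc p r [:: e]) => //=; first by rewrite se eqxx.
  by rewrite er.
have [F FP] := choice exF.
pose b n := iter n (fun s => (F s).2) (exist _ p (same_class_refl Dp)).
apply: (@ClassRay _ (fun n => sval (b n)) (fun n => (F (b n)).1)).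
- by move=> n; have pb := svalP (b n); split; [exact: same_class_in pb|exact: fr].
- by move=> n; exact: FP.
- apply: class_of_ray (fun n => (F (b n)).1) _ _ _ => // n; exact: svalP.
Qed.

End PartialAction.

(** * Atomic families as partial actions up to phases; left regular type *)

Section AtomicFamily.
Variables (R : realType) (G : digraph) (H : hilbertType R) (S : op_family G H).
Variables (B : Type) (vtx : B -> vert G) (D : set B) (move : edge G -> B -> B).
Variable bv : B -> H.
Local Notation C := R[i].

(** The basis vector at [p] up to a phase; working with this set avoids naming the phases collected
    along a path. *)
Definition ray p : set H := [set x | exists2 lam : C, `|lam| = 1 & x = lam *: bv p].

Hypothesis move_in : forall e p, D p -> src e = vtx p -> D (move e p).
Hypothesis move_vtx : forall e p, vtx (move e p) = rng e.
Hypothesis move_inj : forall e f p q, D p -> D q -> src e = vtx p -> src f = vtx q ->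
  move e p = move f q -> e = f /\ p = q.
Hypothesis bv_onb : is_onb D bv.
Hypothesis bv_vertex : forall u p, D p ->
  fam_v S u (bv p) = if vtx p == u then bv p else 0.
Hypothesis bv_edge : forall e p, D p -> src e = vtx p -> ray (move e p) (fam_e S e (bv p)).
Hypothesis bv_edge0 : forall e p, D p -> src e != vtx p -> fam_e S e (bv p) = 0.

Local Notation moves := (moves move).
Local Notation descendants := (descendants vtx move).
Local Notation acyclic_at := (acyclic_at vtx move).

(** Unlike in [fam_path], the empty path acts as the identity; on vectors of [ray p], with [p] in
    [D], and paths with source [vtx p], the two agree. *)
Definition iter_edges mu (x : H) := foldr (fun e => fam_e S e) x mu.

Lemma ray_refl p : ray p (bv p).
Proof. by exists 1; rewrite ?normr1 ?scale1r. Qed.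

Lemma ray_vertex u p x : D p -> ray p x ->
  fam_v S u x = if vtx p == u then x else 0.
Proof.
move=> Dp [lam _ ->]; rewrite linearZ /= bv_vertex//.
by case: eqP => //; rewrite scaler0.
Qed.

Lemma ray_edge e p x : D p -> src e = vtx p -> ray p x -> ray (move e p) (fam_e S e x).
Proof.
move=> Dp se [lam lam1 ->]; have [c c1 ec] := bv_edge Dp se.
by exists (lam * c); rewrite ?normrM ?lam1 ?c1 ?mulr1// linearZ /= ec scalerA.
Qed.

Lemma ray_edge0 e p x : D p -> src e != vtx p -> ray p x -> fam_e S e x = 0.
Proof. by move=> Dp se [lam _ ->]; rewrite linearZ /= bv_edge0// scaler0. Qed.

Lemma ray_moves mu p x : D p -> is_path (vtx p) mu -> ray p x ->
  ray (moves mu p) (iter_edges mu x).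
Proof.
move=> Dp; elim: mu => //= e mu IHmu /andP[/eqP se pmu] px.
by apply: ray_edge; [exact: (moves_in move_in move_vtx)|
  rewrite (moves_vtx move_vtx)|exact: IHmu].
Qed.

Definition class_subspace (A : set B) : closed_subspace H := cspan (bv @` A).

Lemma class_subspace_ray (A : set B) p x : A p -> ray p x -> class_subspace A x.
Proof. by move=> Ap [lam _ ->]; apply: csZ; apply: cspan_sub; exists p. Qed.

Lemma class_subspace_stable (A : set B) : A `<=` D ->
  (forall e p, A p -> src e = vtx p -> A (move e p)) -> fam_stable S (class_subspace A).
Proof.
move=> AD Am; apply: fam_stable_span => [v|e] _ [p Ap <-].
  rewrite bv_vertex; last exact: AD.
  by case: eqP => _; [apply: cspan_sub; exists p|exact: cs0].
have [se|se] := eqVneq (src e) (vtx p).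
  by apply: (@class_subspace_ray _ (move e p)); [exact: Am|apply: bv_edge => //; exact: AD].
by rewrite bv_edge0//; [exact: cs0|exact: AD].
Qed.

Lemma descendants_in r : D r -> descendants r `<=` D.
Proof. by move=> Dr _ [mu pmu <-]; exact: (moves_in move_in move_vtx). Qed.

Lemma descendants_move r e p : descendants r p -> src e = vtx p ->
  descendants r (move e p).
Proof.
move=> [mu pmu <-]; rewrite (moves_vtx move_vtx)// => se.
by exists (e :: mu) => //=; rewrite /= se eqxx.
Qed.

Lemma descendants_stable r : D r -> fam_stable S (class_subspace (descendants r)).
Proof.
by move=> Dr; apply: class_subspace_stable; [exact: descendants_in|exact: descendants_move].
Qed.

Lemma is_onb_ray (T : Type) (D' : set T) (A : set B) (eta : T -> cs_type (class_subspace A))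
    (g : T -> B) : A = g @` D' ->
  (forall t, D' t -> D (g t) /\ ray (g t) (cs_val (eta t))) ->
  (forall t u, D' t -> D' u -> g t = g u -> t = u) ->
  is_onb D' eta.
Proof.
move=> AE geta ginj.
have exlam t : exists lam : C, D' t ->
    [/\ D (g t), `|lam| = 1 & cs_val (eta t) = lam *: bv (g t)].
  (* The value [0] outside [D'] is a placeholder that lets [choice] produce a total function. *)
  have [Dt|nDt] := pselect (D' t); last by exists 0 => /nDt.
  by have [Dgt [lam lam1 etE]] := geta _ Dt; exists lam.
have [lam lamP] := choice exlam.
by apply: (is_onb_rescale bv_onb (g := g) (lam := lam)); rewrite -?AE.
Qed.

(** Acyclicity makes the indices [moves mu r] distinct, and the basis [iter_edges mu x] satisfies
    the edge relations without phases by construction. The equation for [A] lets the lemma apply to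
    a class together with its given stability proof. *)
Lemma left_regular_descendants (A : set B) (SA : fam_stable S (class_subspace A)) r x :
  A = descendants r -> D r -> acyclic_at r -> ray r x ->
  is_left_regular_on (fam_restrict SA) (vtx r) (fun mu => to_cs _ (iter_edges mu x)).
Proof.
move=> AE Dr fr rx.
have valE mu : is_path (vtx r) mu ->
    cs_val (to_cs (class_subspace A) (iter_edges mu x)) = iter_edges mu x.
  move=> pmu; apply: to_csK; apply: (@class_subspace_ray _ (moves mu r)).
    by rewrite AE; exists mu.
  exact: ray_moves.
split.
- apply: (is_onb_ray (g := fun mu => moves mu r)) => //.
    move=> mu pmu; rewrite valE//.
    by split; [exact: (moves_in move_in move_vtx)|exact: ray_moves].
  by move=> mu nu pmu pnu; exact: (acyclic_at_inj move_in move_vtx move_inj Dr).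
- move=> u mu pmu; apply: cs_inj; rewrite fam_restrict_v valE//.
  rewrite (ray_vertex _ (moves_in move_in move_vtx Dr pmu)
    (ray_moves Dr pmu rx))// (moves_vtx move_vtx)//.
  by case: ifP; rewrite ?valE.
- move=> e mu pmu; apply: cs_inj; rewrite fam_restrict_e valE//.
  case: eqP => [se|/eqP se]; first by rewrite valE//= se eqxx.
  by rewrite (ray_edge0 (moves_in move_in move_vtx Dr pmu) _
    (ray_moves Dr pmu rx))// (moves_vtx move_vtx).
Qed.

Lemma class_subspace_mono (A A' : set B) : A `<=` A' ->
  class_subspace A `<=` class_subspace A'.
Proof.
move=> AA'; apply: cspan_min => _ [p Ap <-]; apply: cspan_sub.
by exists p => //; exact: AA'.
Qed.

(** * Classes of inductive type *)

Section Inductive.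
Variables (A : set B) (SA : fam_stable S (class_subspace A)).
Variables (b : nat -> B) (tau : nat -> edge G).
Hypothesis bD : forall n, D (b n) /\ acyclic_at (b n).
Hypothesis bS : forall n, src (tau n) = vtx (b n.+1) /\ move (tau n) (b n.+1) = b n.
Hypothesis AE : A = \bigcup_n descendants (b n).

Lemma ray_ipath : is_ipath tau.
Proof. by move=> n; rewrite (bS n).1 -(bS n.+1).2 move_vtx. Qed.

Lemma ray_ipath_vert n : ipath_vert tau n = vtx (b n).
Proof. by case: n => [|n] /=; [rewrite -(bS 0).2 move_vtx|rewrite (bS n).1]. Qed.

(* The phases are fixed one step at a time so that [tau n] maps the root vector of
   level [n.+1] exactly to that of level [n]. *)
Lemma root_vectors : exists x : nat -> H,
  forall n, ray (b n) (x n) /\ fam_e S (tau n) (x n.+1) = x n.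
Proof.
have step n (c : C) : exists d : C, `|c| = 1 ->
    `|d| = 1 /\ fam_e S (tau n) (d *: bv (b n.+1)) = c *: bv (b n).
  have [lam lam1 lamE] := bv_edge (bD n.+1).1 (bS n).1.
  exists (c / lam) => c1; rewrite normrM normfV c1 lam1 mul1r invr1; split=> //.
  rewrite linearZ /= lamE (bS n).2 scalerA divfK//.
  by rewrite -normr_gt0 lam1.
have exF n : exists f : C -> C, forall c, `|c| = 1 ->
    `|f c| = 1 /\ fam_e S (tau n) (f c *: bv (b n.+1)) = c *: bv (b n).
  by have [f fP] := choice (step n); exists f.
have [F FP] := choice exF.
pose c n := iteri n F 1.
have c1 n : `|c n| = 1 by elim: n => [|n IHn]; [exact: normr1|exact: (FP n _ IHn).1].
exists (fun n => c n *: bv (b n)) => n; split; first by exists (c n).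
exact: (FP n _ (c1 n)).2.
Qed.

Lemma inductive_class : is_inductive (fam_restrict SA) tau.
Proof.
have [x xP] := root_vectors.
(* The inductive system consists of these increasing subspaces, each of left regular type at [b n];
   all connecting maps are inclusions. *)
pose M n := class_subspace (descendants (b n)).
have Mi n : M n `<=` class_subspace A.
  by apply: class_subspace_mono; rewrite AE => p pn; exists n.
have sub n : descendants (b n) `<=` descendants (b n.+1).
  move=> _ [mu pmu <-]; exists (mu ++ [:: tau n]); last first.
    by rewrite moves_cat /= (bS n).2.
  by rewrite /= is_path_cat /= (bS n).1 eqxx /= -(move_vtx _ (b n.+1)) (bS n).2.
have MS n : M n `<=` M n.+1 by exact: class_subspace_mono.
have xin n mu : is_path (vtx (b n)) mu -> M n (iter_edges mu (x n)).
  move=> pmu; apply: (@class_subspace_ray _ (moves mu (b n))); first by exists mu.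
  by apply: ray_moves => //; [exact: (bD n).1|exact: (xP n).1].
exists (fun n => cs_type (M n)), (fun n => fam_restrict (descendants_stable (bD n).1)),
  (fun n mu => to_cs (M n) (iter_edges mu (x n))), (fun n => cs_incl (MS n)),
  (fun n => cs_incl (Mi n)); split.
- move=> n; rewrite ray_ipath_vert.
  by apply: left_regular_descendants => //; [exact: (bD n).1|
    exact: (bD n).2|exact: (xP n).1].
- move=> n; split; first by move=> y.
  (* Both sides are the same vector of [H], since [tau n] sends the root vector of level [n.+1]
     exactly to that of level [n]. *)
  rewrite ray_ipath_vert => mu pmu; apply: cs_inj.
  rewrite cs_incl_val !to_csK.
  + by rewrite /iter_edges foldr_rcons (xP n).2.
  + rewrite /iter_edges foldr_rcons (xP n).2; apply: MS; exact: xin.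
  + exact: xin.
- split=> //; first by move=> n y; exact: cs_inj.
  pose U := \bigcup_n range (cs_incl (Mi n)).
  have inU n (y : cs_type (class_subspace A)) : M n (cs_val y) -> U y.
    by move=> My; exists n => //; exists (CsVec My) => //; exact: cs_inj.
  have Mle m n : (m <= n)%N -> M m `<=` M n.
    elim: n => [|n IHn]; first by rewrite leqn0 => /eqP ->.
    by rewrite leq_eqVlt ltnS => /predU1P[->//|/IHn mn]; exact: subset_trans (MS n).
  have U0 : U 0 by apply: (inU 0); exact: cs0.
  (* Because the [M n] increase, their union is already a linear subspace, and density of its span
     is density of the union. *)
  have UP (a : C) y z : U y -> U z -> U (a *: y + z).
    move=> [m _ [y' _ <-]] [n _ [z' _ <-]]; apply: (inU (maxn m n)).
    apply: csP; first by apply: (Mle m); [exact: leq_maxl|exact: cs_in].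
    by apply: (Mle n); [exact: leq_maxr|exact: cs_in].
  have h : closure (linear_span U) = setT.
    apply: (@dense_in_cspan _ _ _ (bv @` A)) => // _ [p Ap <-].
    have Mp : class_subspace A (bv p) by apply: cspan_sub; exists p.
    exists (CsVec Mp) => //; apply: linear_span_sub.
    have [n _ pn] : (\bigcup_n descendants (b n)) p by rewrite -AE.
    by apply: (inU n); apply: cspan_sub; exists p.
  apply/seteqP; split=> // y _.
  have : closure (linear_span U) y by rewrite h.
  by apply: closureS; exact: linear_span_min.
- move=> v mu _ n y; apply: cs_inj.
  by rewrite fam_restrict_path !cs_incl_val fam_restrict_path.
Qed.

End Inductive.

(** * Classes of cycle type *)

Section Cycle.
Variables (A : set B) (SA : fam_stable S (class_subspace A)).
Variables (r : B) (w : seq (edge G)).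
Hypotheses (Dr : D r) (pw : is_path (vtx r) w) (w0 : w <> [::]) (wr : moves w r = r).
Hypothesis w_min : forall nu, is_path (vtx r) nu -> nu <> [::] -> moves nu r = r ->
  (size w <= size nu)%N.
Hypothesis AE : A = descendants r.
Local Notation k := (size w).

(* [e_j ... e_1], for [w = e_k ... e_1]. *)
Let pre j := drop (k - j) w.
Let cp j := moves (pre j) r.

Lemma cycle_size : (0 < k)%N. Proof. by case: (w) w0. Qed.

Let pre0 : pre 0 = [::]. Proof. by rewrite /pre subn0 drop_size. Qed.
Let prek : pre k = w. Proof. by rewrite /pre subnn drop0. Qed.

Let preS (j : 'I_k) : pre j.+1 = cycle_edge j :: pre j.
Proof.
have jk := ltn_ord j.
have kj : (k - j.+1 < k)%N by rewrite ltn_subrL cycle_size.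
rewrite /pre (drop_nth (cycle_edge j) kj) -subSn// subSS; congr cons.
by rewrite [RHS]/cycle_edge (tnth_nth (cycle_edge j)) /= nth_rev.
Qed.

Let pre_path j : is_path (vtx r) (pre j).
Proof. by have := pw; rewrite -{1}(cat_take_drop (k - j) w) is_path_cat => /andP[]. Qed.

Let size_pre j : (j <= k)%N -> size (pre j) = j.
Proof. by move=> jk; rewrite size_drop subKn. Qed.

Let cpD j : D (cp j).
Proof. exact: (moves_in move_in move_vtx). Qed.

Let cp_src (j : 'I_k) : src (cycle_edge j) = vtx (cp j).
Proof.
have := pre_path j.+1; rewrite preS /= => /andP[/eqP -> _].
by rewrite (moves_vtx move_vtx).
Qed.

Let cpS (j : 'I_k) : cp j.+1 = move (cycle_edge j) (cp j).
Proof. by rewrite /cp preS. Qed.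

Let cp0 : cp 0 = r. Proof. by rewrite /cp pre0. Qed.
Let cpk : cp k = r. Proof. by rewrite /cp prek. Qed.

Let cp_next (j : 'I_k) : exists j' : 'I_k, cp j' = move (cycle_edge j) (cp j).
Proof.
have [jk|jk] := ltnP j.+1 k; first by exists (Ordinal jk); rewrite -cpS.
exists (Ordinal cycle_size); rewrite -cpS /= cp0.
by rewrite (_ : j.+1 = k) ?cpk//; apply/eqP; rewrite eqn_leq jk ltn_ord.
Qed.

Let cp_prev (j' : 'I_k) : exists j : 'I_k, cp j' = move (cycle_edge j) (cp j).
Proof.
case: j' => -[|j] jk /=.
  (* The index [r] is both [cp 0] and [cp k], so its predecessor is [cp k.-1]. *)
  have kk : (k.-1 < k)%N by rewrite prednK ?cycle_size.
  by exists (Ordinal kk); rewrite -cpS /= prednK ?cycle_size// cp0 cpk.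
by exists (Ordinal (ltnW jk)); rewrite -cpS.
Qed.

(** If two points agreed, cancellation would leave a loop at [r] of length [j - i], shorter than
    [w], against [w_min]. *)
Let cp_inj (i j : 'I_k) : cp i = cp j -> i = j.
Proof.
wlog ij : i j / (i <= j)%N.
  move=> h E; have [s|/ltnW s] := leqP i j; first exact: h.
  by apply/esym; exact: h.
have ik := ltnW (ltn_ord i); have jk := ltnW (ltn_ord j).
move=> E; have [|nu [nuE pnu nur]] := moves_cancel move_in move_vtx move_inj Dr Dr
  (pre_path i) (pre_path j) _ E; first by rewrite !size_pre.
have sE : (j = i + size nu :> nat)%N.
  by have := congr1 size nuE; rewrite size_cat !size_pre.
apply/val_inj => /=; rewrite sE.
have [->|/eqP nu0] := eqVneq nu [::]; first by rewrite addn0.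
have := w_min pnu nu0 (esym nur).
rewrite leqNgt (leq_trans _ (ltn_ord j))// sE ltnS leq_addl //.
Qed.

(** The unique predecessor of a cycle point is a cycle point, so a path ending on the cycle has run
    along it throughout; a branch that leaves the cycle never returns. *)
Let cycle_point_back mu f q (j' : 'I_k) : D q -> src f = vtx q ->
  is_path (rng f) mu -> moves mu (move f q) = cp j' ->
  exists j : 'I_k, f = cycle_edge j /\ q = cp j.
Proof.
move=> Dq sf; elim: mu j' => [|e mu IHmu] j' /=; have [j ->] := cp_prev j'.
  by move=> _ /(move_inj Dq (cpD j) sf (cp_src j))[-> ->]; exists j.
move=> /andP[/eqP se pmu].
have pmu' : is_path (vtx (move f q)) mu by rewrite move_vtx.
have Dm := moves_in move_in move_vtx (move_in Dq sf) pmu'.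
move=> /(move_inj Dm (cpD j) _ (cp_src j))[|_]; last exact: IHmu.
by rewrite (moves_vtx move_vtx) move_vtx.
Qed.

Local Notation index := ('I_k + 'I_k * edge G * seq (edge G))%type.
Let D' : set index := [set b | match b with
  inl _ => True | inr (j, f, mu) => cycle_index j f mu end].
Let g (b : index) := match b with
  inl j => cp j | inr (j, f, mu) => moves mu (move f (cp j)) end.

Let branch_path (j : 'I_k) f mu : cycle_index j f mu ->
  is_path (vtx r) (mu ++ f :: pre j).
Proof.
move=> [_ sf pmu]; rewrite is_path_cat /= pre_path pmu sf cp_src.
by rewrite (moves_vtx move_vtx) eqxx.
Qed.

Let branchE (j : 'I_k) f mu : moves mu (move f (cp j)) = moves (mu ++ f :: pre j) r.
Proof. by rewrite moves_cat. Qed.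

Let g_image : A = g @` D'.
Proof.
rewrite AE; apply/seteqP; split=> [_ [mu pmu <-]|_ [[j|[[j f] mu]] Db <-]]; last 2 first.
- by exists (pre j); first exact: pre_path.
- by exists (mu ++ f :: pre j); [exact: branch_path|rewrite -branchE].
(* A further edge [e] either continues along the cycle, or leaves it and starts a branch, or
   prolongs a branch. *)
elim: mu pmu => [_|e mu IHmu /= /andP[/eqP se pmu]].
  by exists (inl (Ordinal cycle_size)); rewrite //= cp0.
have [[j|[[j f] nu]] Db gb] := IHmu pmu.
  have [->|ej] := eqVneq e (cycle_edge j).
    by have [j' j'E] := cp_next j; exists (inl j'); rewrite //= -gb /= j'E.
  exists (inr (j, e, [::])); rewrite /= -?gb//; split=> //.
  by rewrite se cp_src -/(g (inl j)) gb (moves_vtx move_vtx).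
exists (inr (j, f, e :: nu)); rewrite /= -?gb//.
case: Db => fj sf pnu; split=> //=; rewrite pnu andbT se.
have := congr1 vtx gb; rewrite /= !(moves_vtx move_vtx) move_vtx => ->.
by rewrite eqxx.
Qed.

Let g_inj t u : D' t -> D' u -> g t = g u -> t = u.
Proof.
have branch_ne (j j' : 'I_k) f mu : cycle_index j f mu -> moves mu (move f (cp j)) <> cp j'.
  move=> [fj sf pmu]; have sf' : src f = vtx (cp j) by rewrite sf cp_src.
  move=> /(cycle_point_back (cpD j) sf' pmu)[i [fi /cp_inj ij]].
  by move: fj; rewrite fi ij eqxx.
case: t => [j|[[j f] mu]]; case: u => [j'|[[j' f'] mu']] //=.
- by move=> _ _ /cp_inj ->.
- by move=> _ h /esym /(branch_ne _ _ _ _ h).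
- by move=> h _ /(branch_ne _ _ _ _ h).
wlog s : j f mu j' f' mu' / (size mu <= size mu')%N.
  move=> h Dt Du E; have [s|/ltnW s] := leqP (size mu) (size mu'); first exact: h.
  by apply/esym; exact: h.
move=> [fj sf pmu] [fj' sf' pmu'].
rewrite cp_src in sf; rewrite cp_src in sf'.
have pm : is_path (vtx (move f (cp j))) mu by rewrite move_vtx.
have pm' : is_path (vtx (move f' (cp j'))) mu' by rewrite move_vtx.
move=> /(moves_cancel move_in move_vtx move_inj (move_in (cpD j) sf)
  (move_in (cpD j') sf') pm pm' s)[[|e nu] [-> pnu]] /=.
  by move=> /(move_inj (cpD _) (cpD _) sf sf')[-> /cp_inj ->]; rewrite cats0.
(* If one branch path is longer, the leftover [e :: nu] would put the cycle point [cp j] on the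
   branch of [f'] at [cp j']. *)
move: pnu => /= /andP[/eqP se pnu].
have Dm := moves_in move_in move_vtx (move_in (cpD j') sf') pnu.
rewrite -(moves_vtx move_vtx) in se.
move=> /(move_inj (cpD _) Dm sf se)[_ /esym].
have ci : cycle_index j' f' nu.
  by split=> //; [rewrite sf' cp_src|move: pnu; rewrite move_vtx].
by move=> /(branch_ne _ _ _ _ ci).
Qed.

Lemma cycle_is_cycle : is_cycle (vtx r) w.
Proof. by rewrite /is_cycle cycle_size pw -(moves_vtx move_vtx) wr eqxx. Qed.

Lemma cycle_class : exists2 lam : C, `|lam| = 1 & is_cycle_type (fam_restrict SA) w lam.
Proof.
(* [lam] is the total phase picked up by [bv r] in one turn round the cycle. *)
have [lam lam1 lamE] := ray_moves Dr pw (ray_refl r).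
exists lam => //.
pose x j := iter_edges (pre j) (bv r).
have xray j : ray (cp j) (x j) by apply: ray_moves => //; exact: ray_refl.
pose y (j : 'I_k) f mu := iter_edges mu (fam_e S f (x j)).
have yray j f mu : cycle_index j f mu -> ray (moves mu (move f (cp j))) (y j f mu).
  move=> [_ sf pmu]; apply: ray_moves; last by apply: ray_edge; rewrite ?sf ?cp_src.
    by apply: move_in; rewrite ?sf ?cp_src.
  by rewrite move_vtx.
have yvtx (j : 'I_k) f mu : cycle_index j f mu ->
    D (moves mu (move f (cp j))) /\ vtx (moves mu (move f (cp j))) = path_rng (rng f) mu.
  move=> ci; split; last by rewrite (moves_vtx move_vtx) move_vtx.
  by rewrite branchE; apply: (moves_in move_in move_vtx) => //; exact: branch_path.
have xin (j : 'I_k) : cs_val (to_cs (class_subspace A) (x j)) = x j.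
  by apply: to_csK; apply: class_subspace_ray (xray j); rewrite g_image; exists (inl j).
have yin j f mu : cycle_index j f mu ->
    cs_val (to_cs (class_subspace A) (y j f mu)) = y j f mu.
  move=> ci; apply: to_csK; apply: class_subspace_ray (yray _ _ _ ci).
  by rewrite g_image; exists (inr (j, f, mu)).
exists (fun j => to_cs _ (x j)), (fun j f mu => to_cs _ (y j f mu)); split.
- apply: is_onb_ray g_image _ g_inj => -[j _|[[j f] mu] ci] /=.
    by rewrite xin; split; [exact: cpD|exact: xray].
  by rewrite yin//; split; [exact: (yvtx _ _ _ ci).1|exact: yray].
- move=> v j; apply: cs_inj; rewrite fam_restrict_v xin.
  rewrite (ray_vertex _ (cpD j) (xray j)) cp_src eq_sym.
  by case: ifP; rewrite ?xin.
- move=> v j f mu ci; apply: cs_inj; rewrite fam_restrict_v yin//.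
  rewrite (ray_vertex _ (yvtx _ _ _ ci).1 (yray _ _ _ ci)) (yvtx _ _ _ ci).2 eq_sym.
  by case: ifP; rewrite ?yin.
- move=> j j' j'E; apply: cs_inj; rewrite fam_restrict_e !xin /x.
  by move: j'E => /= ->; rewrite preS.
- move=> j j' jk j'0; apply: cs_inj; rewrite fam_restrict_e linearZ /= !xin /x.
  (* The vectors [x j] absorb the phases of all earlier edges, so that the closing edge alone
     carries [lam]. *)
  have E : iter_edges (pre j.+1) (bv r) = lam *: bv r by rewrite jk prek lamE wr.
  by move: j'0 => /= ->; rewrite pre0 /= -E preS.
- move=> j e ej se; apply: cs_inj; rewrite fam_restrict_e xin yin//.
- move=> j e se; apply: cs_inj; rewrite fam_restrict_e xin.
  by apply: ray_edge0 (cpD j) _ (xray j); rewrite -cp_src.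
- move=> e j f mu ci; apply: cs_inj; rewrite fam_restrict_e yin//.
  have [Dm vm] := yvtx _ _ _ ci.
  case: eqP => [se|/eqP se]; last first.
    by apply: ray_edge0 Dm _ (yray _ _ _ ci); rewrite vm.
  by rewrite yin//; case: ci => fj sf pmu; split=> //=; rewrite se eqxx.
Qed.

End Cycle.
End AtomicFamily.

(** * Orthogonal projections onto closed subspaces *)

Section Projections.
Variables (R : realType) (H : hilbertType R) (P : H -> H) (M : closed_subspace H).
Hypothesis PM : projection_onto P M.

Lemma inner_self_eq0 (x : H) : inner x x = 0 -> x = 0.
Proof. by rewrite inner_norm => /eqP; rewrite sqrf_eq0 normr_eq0 => /eqP. Qed.

(** The difference [x - P x] lies in [M] and is orthogonal to [M], hence to itself. *)
Lemma projection_onto_id x : M x -> P x = x.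
Proof.
move=> Mx; have [MPx Px] := PM x; apply/esym/eqP; rewrite -subr_eq0; apply/eqP.
by apply: inner_self_eq0; apply: Px; apply: csD => //; exact: csN.
Qed.

Lemma projection_onto_orthogonal x : (forall y, M y -> inner x y = 0) -> P x = 0.
Proof.
move=> xM; have [MPx /(_ _ MPx)] := PM x.
rewrite innerBl xM// sub0r => /eqP; rewrite oppr_eq0 => /eqP.
exact: inner_self_eq0.
Qed.

End Projections.

(** * Decomposition of an atomic family along the classes of its basis *)

Theorem theorem11p13 (R : realType) (G : digraph) (H : hilbertType R)
    (S : op_family G H)
    (tckS : is_tck S) (ndS : is_nondegenerate S) (atS : is_atomic S) :
  exists (I : choiceType) (K : I -> hilbertType R)
    (T : forall i : I, op_family G (K i)) (T_sum : op_family G (hilbert_sum K)),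
    (forall i : I,
       (exists v : vert G, is_left_regular (T i) v) \/
       (exists tau : nat -> edge G, is_ipath tau /\ is_inductive (T i) tau) \/
       (exists (v : vert G) (w : seq (edge G)) (lam : R[i]),
          [/\ is_cycle v w, `|lam| = 1 & is_cycle_type (T i) w lam])) /\
    is_direct_sum T T_sum /\
    unitarily_equivalent S T_sum.
Proof.
have [X [Lam [xi [pi atomS]]]] := atS.
pose B := (vert G * X)%type.
pose D : set B := [set p | Lam p.1 p.2].
pose move e (p : B) : B := (rng e, pi e p.2).
pose bv (p : B) := xi p.1 p.2.
pose vtx (p : B) := p.1.
have onb : is_onb D bv := atomic_onb atomS.
have move_in e p : D p -> src e = vtx p -> D (move e p).
  by move=> Dp se; apply: (atomic_maps atomS); rewrite se.
have move_vtx e p : vtx (move e p) = rng e by [].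
have move_inj e f p q : D p -> D q -> src e = vtx p -> src f = vtx q ->
    move e p = move f q -> e = f /\ p = q.
  case: p q => [v i] [u j]; rewrite /D /vtx /move /= => + + sv su.
  rewrite -sv -su => Li Lj [ref pij].
  (* For one edge this is injectivity of its map; two different edges with the same range have
     disjoint images. *)
  have [ef|/(atomic_ranges atomS)/(_ ref) h] := eqVneq e f.
    by subst f; rewrite (atomic_inj atomS Li Lj pij).
  have : set0 (pi e i) by rewrite -h; split; [exists i|exists j].
  by [].
have bv_vertex u p : D p -> fam_v S u (bv p) = if vtx p == u then bv p else 0.
  move=> Dp; have prj := atomic_vertex atomS u.
  case: eqP => [pu|/eqP pu].
    apply: (@projection_onto_id _ _ _ (cspan (xi u @` Lam u))) => //.
    by apply: cspan_sub; exists p.2; rewrite -pu.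
  apply: (@projection_onto_orthogonal _ _ _ (cspan (xi u @` Lam u))) => // y.
  move=> /(cspan_orthogonal (A := [set bv p])); apply; last exact: cspan_sub.
  move=> _ _ -> [i Li <-]; have [_ onb0 _] := onb.
  apply: (onb0 p (u, i)) => //.
  by move=> pE; move: pu; rewrite pE eqxx.
have bv_edge e p : D p -> src e = vtx p -> ray bv (move e p) (fam_e S e (bv p)).
  case: p => v i; rewrite /D /vtx /= => + sv; rewrite -sv => Li.
  by have [lam [lam1 lamE]] := atomic_edge atomS Li; exists lam; rewrite // /bv /= -sv.
have bv_edge0 e p : D p -> src e != vtx p -> fam_e S e (bv p) = 0.
  by move=> Dp; rewrite eq_sym => sp; exact: (atomic_edge0 atomS sp Dp).
pose cls := same_class vtx D move.
(* The summands are indexed by the classes themselves, as subsets of [B], so each class occurs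
   exactly once; [{classic _}] supplies the choice structure. *)
pose I : choiceType := {classic {A : set B | exists2 p, D p & A = cls p}}.
pose M (i : I) := class_subspace bv (sval i).
have cls_in (i : I) : sval i `<=` D.
  by case: i => A [p Dp AE] q /=; rewrite AE; exact: (same_class_in move_in move_vtx).
have SM (i : I) : fam_stable S (M i).
  apply: (class_subspace_stable bv_vertex bv_edge bv_edge0); first exact: cls_in.
  case: i => A [p Dp AE] /= e q; rewrite AE => pq se.
  apply: (same_class_moves move_vtx (mu := [:: e])) => //=.
  by rewrite se eqxx.
have orth (i j : I) x y : i <> j -> M i x -> M j y -> inner x y = 0.
  move=> ij; apply: cspan_orthogonal => _ _ [p ip <-] [q jq <-].
  have [_ onb0 _] := onb; apply: onb0; [exact: (cls_in i)|exact: (cls_in j)|].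
  (* Basis vectors of different classes have different indices, since a shared index would make the
     classes equal. *)
  move=> pq; apply: ij; subst q.
  case: i j ip jq => A [a Da AE] [A' [a' Da' AE']] /= ip jp.
  apply: eq_exist => /=; move: ip jp; rewrite AE AE' => ap a'p.
  by rewrite /cls (same_class_classE move_in move_vtx move_inj ap)
    (same_class_classE move_in move_vtx move_inj a'p).
have total (N : closed_subspace H) : (forall i, M i `<=` N) -> forall x, N x.
  move=> MN x; have [_ _ dense] := onb.
  have : cspan (bv @` D) x by rewrite /= dense.
  apply: cspan_min => _ [p Dp <-].
  (* Each basis vector lies in the subspace of its own class, so totality follows from density of
     the span of the basis. *)
  pose i : I := exist _ (cls p) (ex_intro2 _ _ p Dp erefl).
  apply: (MN i); apply: cspan_sub; exists p => //.
  exact: same_class_refl.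
exists I, (fun i => cs_type (M i)), (fun i => fam_restrict (SM i)),
  (hs_family orth SM); split; last split; last 2 first.
- exact: hs_family_direct_sum.
- exact: hs_family_equivalent.
move=> i; have [p Dp iE] := svalP i.
have := same_class_cases move_in move_vtx move_inj Dp; rewrite -/cls -iE.
move=> [r Dr fr AE|b tau bD bS AE|r w Dr pw w0 wr wmin AE].
- left; exists (vtx r); eexists.
  exact: (left_regular_descendants move_in move_vtx move_inj onb bv_vertex bv_edge
    bv_edge0 (SM i) AE Dr fr (ray_refl _ _)).
- right; left; exists tau; split; first exact: (ray_ipath move_vtx bS).
  exact: (inductive_class move_in move_vtx move_inj onb bv_vertex bv_edge bv_edge0
    (SM i) bD bS AE).
- right; right.
  have [lam lam1 lamP] := cycle_class move_in move_vtx move_inj onb bv_vertex bv_edge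
    bv_edge0 (SM i) Dr pw w0 wr wmin AE.
  by exists (vtx r), w, lam; split=> //; exact: (cycle_is_cycle move_vtx pw w0 wr).
Qed.
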